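(* Let $n,m$ be positive even integers and let $F$ be a subgroup of $C_n\times C_m\subset SO(2)\times SO(2)$. (i) If $F$ belongs to class $\mathrm{E}_2$, $\mathrm{E}_3$ or $\mathrm{E}_4$, then $\mathcal H(F)=\{0\}$. (ii) If $F$ belongs to class $\mathrm{O}$ or to class $\mathrm{E}_1$, then $\mathcal H(F)$ consists of functions which are arbitrary on the elementary region $\mathrm{E}$ for $F$; in particular there are bijections $$\mathcal H(\mathrm{E})\leftrightarrow\mathcal H_{\mathrm{E}}(\mathcal P)\leftrightarrow\mathcal H(F),$$ where the first is extension by $0$ outside $\mathrm{E}$ (with inverse restriction to $\mathrm{E}$), and the second is $\sigma:\mathcal H_{\mathrm{E}}(\mathcal P)\to\mathcal H(F)$, $\sigma(f)=\frac{1}{|\mathrm{K}_F|}\sum_{g\in F}T'(g)f$, with inverse $\rho(f)=\chi_{\mathrm{E}}\cdot f$.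
   Context: $\mathcal P=P_1(\mathbb R)\times P_1(\mathbb R)$ is the torus, with points $(x,y)$ and angular coordinates $(\rho,\sigma)$ taken mod $2\pi$, where $x=\cot(\rho/2)$, $y=\cot(\sigma/2)$. $\mathcal H(\mathcal P)$ is the real Hilbert space of real-valued functions on $\mathcal P$ square integrable for Lebesgue measure $d\rho\,d\sigma$ (functions identified when equal almost everywhere). The group $SL(2,\mathbb R)\times SL(2,\mathbb R)$ acts on $\mathcal P$ from the right by $(x,y)\mapsto(xg,yh)$, where for $g=\begin{pmatrix}a&b\\c&d\end{pmatrix}$, $xg=\frac{xa+c}{xb+d}$, and it acts on $\mathcal H(\mathcal P)$ by $$(T'(g,h)\phi)(x,y)=k_g^{-3}(x)s_g(x)k_h^{-3}(y)s_h(y)\phi(xg,yh),$$ $$k_g(x)=\left\{\frac{(xb+d)^2+(xa+c)^2}{1+x^2}\right\}^{1/2},\qquad s_g(x)=\frac{xb+d}{|xb+d|}.$$ $R(\theta)=\begin{pmatrix}\cos\theta&\sin\theta\\-\sin\theta&\cos\theta\end{pmatrix}$, and $C_n=\{g_r=R(2\pi r/n):0\le r\le n-1\}$. In angular coordinates $(g_i,g_j)\in C_n\times C_m$ acts by $(\rho,\sigma)\mapsto(\rho+\frac{4\pi}{n}i,\sigma+\frac{4\pi}{m}j)$. The kernel of the action of $C_n\times C_m$ on $\mathcal P$ is $\mathrm{K}=\{(\pm I,\pm I)\}$ (all four sign choices), and $\mathrm{K}_F=\mathrm{K}\cap F$. $\mathcal H(F)=\{f\in\mathcal H(\mathcal P):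 T'(h)f=f\ \text{for all }h\in F\}$. Classes of subgroups: let $A=\{(I,I),(-I,-I)\}$, $B=\{(I,I),(-I,I)\}$, $C=\{(I,I),(I,-I)\}$, $D=\{(\pm I,\pm I)\}$ (four elements). Class $\mathrm{O}$: subgroups of $C_n\times C_m$ of odd order. Classes $\mathrm{E}_1,\mathrm{E}_2,\mathrm{E}_3$: subgroups of even order not containing $D$ and containing respectively $A$, $B$, $C$. Class $\mathrm{E}_4$: subgroups (of even order) containing $D$. Elementary region for $F$: let $\mathrm{F}_{nm}=\{(\rho,\sigma):0<\rho<4\pi/n,\ 0<\sigma<4\pi/m\}$ and $\mathrm{E}=\mathrm{F}_{nm}S=\bigcup_{s\in S}\mathrm{F}_{nm}s$, where $S$ is an admissible set of representatives of the left cosets of $F$ in $C_n\times C_m$, constructed as follows. With $G=C_n\times C_m$, $\omega=|\mathrm{K}|/|\mathrm{K}_F|$ and $\theta=|G||\mathrm{K}_F|/(|F||\mathrm{K}|)$, choose successively $g_1,\dots,g_\theta\in G$ and for each $\nu$ a set $\sigma^{(\nu)}=\{\sigma^{(\nu)}_1,\dots,\sigma^{(\nu)}_\omega\}$ of representatives of the cosets of $\mathrm{K}_F$ in $\mathrm{K}$, such that $g_\nu$ lies in none of the cosets $g_\lambda\sigma^{(\lambda)}_\mu F$ with $\lambda<\nu$; then $S=\{g_\nu\sigma^{(\nu)}_\mu\}$. $\mathcal H(\mathrm{E})$ is the Hilbert space of real-valued square integrable functions on $\mathrm{E}$ (for the restricted Lebesgue measure), $\mathcal H_{\mathrm{E}}(\mathcal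 P)\subset\mathcal H(\mathcal P)$ is the subspace of functions vanishing outside $\mathrm{E}$, and $\chi_{\mathrm{E}}$ is the characteristic function of $\mathrm{E}$. *)

(* Defs.v *)
From HB Require Import structures.
From mathcomp Require Import all_boot all_order all_algebra finmap.
From mathcomp Require Import all_classical all_reals all_analysis.
From mathcomp Require Import measurable_realfun ring lra.
Import Order.TTheory GRing.Theory Num.Theory.
Import numFieldNormedType.Exports.

Set Implicit Arguments.
Unset Strict Implicit.
Unset Printing Implicit Defensive.

Local Open Scope classical_set_scope.
Local Open Scope ring_scope.

(* [LspaceType2 mu] is the quotient of square integrable functions by almost
   everywhere equality; the library gives it no module structure, so operators
   on it are defined below on representatives and sent back by [toL2]. *)

Section L2_classes.
Context d (T : measurableType d) (R : realType).
Variable mu : {measure set T -> \bar R}.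
Local Open Scope quotient_scope.

(* [LspaceType2] uses [measurableTypeR R], whose display is not that of the
   (same) Borel structure on [R : realType]. *)
Definition mfunR (f : {mfun T >-> R}) : {mfun T >-> measurableTypeR R} :=
  @mfun_Sub _ _ T (measurableTypeR R) f (mem_set (@measurable_funPT _ _ _ _ f)).

Definition ae_class (f : {mfun T >-> R}) :
  {mfun_ mu, T >-> measurableTypeR R} :=
  \pi_({mfun_ mu, T >-> measurableTypeR R}) (mfunR f).

Lemma ae_classP (f : {mfun T >-> R}) : (ae_class f : T -> R) = f %[ae mu].
Proof.
have /eqmodP/asboolP : repr (ae_class f)
  = mfunR f %[mod {mfun_ mu, T >-> measurableTypeR R}] by rewrite reprK.
by [].
Qed.

Lemma finite_norm_ae (p : R) (f g : T -> R) : measurable_fun setT f ->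
  measurable_fun setT g -> f = g %[ae mu] ->
  finite_norm mu p%:E g -> finite_norm mu p%:E f.
Proof.
move=> mf mg fg; rewrite /finite_norm unlock.
have mp (h : T -> R) : measurable_fun setT h ->
    measurable_fun setT (fun x : T => `|(EFin \o h) x| `^ p)%E.
  move=> mh; apply: (measurableT_comp (measurable_poweR _)) => //.
  by apply: measurableT_comp => //; exact/measurable_EFinP.
suff -> : (\int[mu]_x (`|(EFin \o f) x| `^ p)
         = \int[mu]_x (`|(EFin \o g) x| `^ p))%E by [].
apply: ae_eq_integral; [exact: measurableT|exact: mp|exact: mp|].
by apply: filterS fg => x /= /[apply] ->.
Qed.

Lemma finite_norm_ae_class (f : LfunType mu (@lee1n R 2)) :
  finite_norm mu 2%:E (ae_class f : T -> R).
Proof.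
apply: (finite_norm_ae _ _ (ae_classP _)).
- exact: (@measurable_funPT _ _ _ _ (repr (ae_class f))).
- exact: measurable_funPT.
- exact: Lfunction_finite.
Qed.

Definition class_of_Lfun (f : LfunType mu (@lee1n R 2)) : LspaceType2 mu :=
  LebesgueSpace.Pack (LebesgueSpace.Class
    (isFinLebesgue.Build _ _ _ _ _ (lee1n 2) _ (finite_norm_ae_class f))).

(* The class of [f] if [f] is square integrable, and the class of 0 otherwise. *)
Definition toL2 (f : T -> R) : LspaceType2 mu :=
  class_of_Lfun (insubd (cst 0 : LfunType mu (@lee1n R 2)) f).

Lemma toL2_ae (f : T -> R) : f \in Lfun mu 2%:E ->
  (toL2 f : T -> R) = f %[ae mu].
Proof.
by move=> fL; have := ae_classP (insubd (cst 0 : LfunType mu (@lee1n R 2)) f);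
  rewrite /= [X in _ -> _ = X %[ae _]](_ : f = \val (insubd
    (cst 0 : LfunType mu (@lee1n R 2)) f)) // insubdK.
Qed.

Lemma L2_eqP (u v : LspaceType2 mu) :
  u = v <-> (u : T -> R) = v %[ae mu].
Proof.
split=> [->|]; first exact: ae_eq_refl.
case: u v => [u [[hu]]] [v [[hv]]] /= uv.
have /eqP : repr u == repr v %[mod {mfun_ mu, T >-> measurableTypeR R}].
  by rewrite eqmodE; exact/asboolP.
rewrite !reprK => {}uv; case: _ / uv hv => hv.
by rewrite (bool_irrelevance hu hv).
Qed.

End L2_classes.

(* [None] is the point at infinity. *)
Definition P1 (R : realType) : Type := option R.
HB.instance Definition _ (R : realType) := Choice.on (P1 R).
HB.instance Definition _ (R : realType) := isPointed.Build (P1 R) None.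

Section projective_line.
Context {R : realType}.
Local Notation M2 := 'M[R]_2.

(* the point [cot (rho / 2)] *)
Definition angle (rho : R) : P1 R :=
  if sin (rho / 2) == 0 then None else Some (cos (rho / 2) / sin (rho / 2)).

(* The Borel structure of the circle: [angle] restricts to a bijection from
   [[0, 2 pi[] onto [P1 R]. *)
Definition P1_measurable : set (set (P1 R)) :=
  [set A | measurable (angle @^-1` A)].

Let P1_measurable0 : P1_measurable set0.
Proof. by rewrite /P1_measurable /= preimage_set0. Qed.

Let P1_measurableC A : P1_measurable A -> P1_measurable (~` A).
Proof. by rewrite /P1_measurable /= preimage_setC; exact: measurableC. Qed.

Let P1_measurable_bigcup (F : (set (P1 R))^nat) :
  (forall i, P1_measurable (F i)) -> P1_measurable (\bigcup_i F i).
Proof.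
by move=> mF; rewrite /P1_measurable /= preimage_bigcup; exact: bigcupT_measurable.
Qed.

HB.instance Definition _ := isMeasurable.Build default_measure_display (P1 R)
  P1_measurable0 P1_measurableC P1_measurable_bigcup.

(* the measure [d rho], of total mass [2 pi] *)
Definition P1_measure : set (P1 R) -> \bar R :=
  pushforward (mrestr lebesgue_measure (measurable_itv `[(0 : R), 2 * pi[))
    angle.

Let P1_measure0 : P1_measure set0 = 0%E.
Proof. by rewrite /P1_measure /pushforward preimage_set0 measure0. Qed.

Let P1_measure_ge0 A : (0 <= P1_measure A)%E.
Proof. by rewrite /P1_measure /pushforward; exact: measure_ge0. Qed.

Let P1_measure_sigma_additive : semi_sigma_additive P1_measure.
Proof.
move=> F mF tF mUF; rewrite /P1_measure /pushforward preimage_bigcup.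
apply: measure_semi_sigma_additive => [i||]; first exact: mF.
- apply/trivIsetP => /= i j _ _ ij; rewrite -preimage_setI.
  by move/trivIsetP : tF => /(_ _ _ _ _ ij) ->//; rewrite preimage_set0.
- by rewrite -preimage_bigcup; exact: mUF.
Qed.

HB.instance Definition _ := isMeasure.Build _ _ _ P1_measure
  P1_measure0 P1_measure_ge0 P1_measure_sigma_additive.

Let P1_measure_finite : fin_num_fun P1_measure.
Proof.
move=> A mA; rewrite ge0_fin_numE ?measure_ge0//.
rewrite /P1_measure /pushforward /mrestr.
apply: (@le_lt_trans _ _ (lebesgue_measure `[(0 : R), 2 * pi[)).
  by apply: le_measure; rewrite ?inE//; apply: measurableI => //; exact: mA.
by rewrite lebesgue_measure_itv /= lte_fin; case: ifP => // _; rewrite ltry.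
Qed.

HB.instance Definition _ := Measure_isFinite.Build _ _ _ P1_measure
  P1_measure_finite.

End projective_line.

Arguments P1_measure R : clear implicits.

Definition torus_measure (R : realType) :
  {measure set (P1 R * P1 R) -> \bar R} := (P1_measure R \x P1_measure R)%E.

Notation H_torus R := (LspaceType2 (torus_measure R)).

Section action.
Context {R : realType}.
Local Notation M2 := 'M[R]_2.
Local Notation torus := (P1 R * P1 R)%type.
Implicit Types (x : P1 R) (g : M2) (gh : M2 * M2) (p : torus).

Definition homog x : R * R := if x is Some a then (a, 1) else (1, 0).

(* For finite [x] and [g = (a b; c d)] these are [x a + c] and [x b + d]; the
   values at the point at infinity only matter up to a null set in [T']. *)
Definition mnum g x : R := (homog x).1 * g 0 0 + (homog x).2 * g 1 0.
Definition mden g x : R := (homog x).1 * g 0 1 + (homog x).2 * g 1 1.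

Definition mobius x g : P1 R :=
  if mden g x == 0 then None else Some (mnum g x / mden g x).

Definition kfac g x : R :=
  Num.sqrt ((mden g x ^+ 2 + mnum g x ^+ 2)
            / ((homog x).1 ^+ 2 + (homog x).2 ^+ 2)).

Definition sfac g x : R := mden g x / `|mden g x|.

Definition act p gh : torus := (mobius p.1 gh.1, mobius p.2 gh.2).

Definition T' gh (phi : torus -> R) : torus -> R := fun p =>
  kfac gh.1 p.1 ^- 3 * sfac gh.1 p.1 * (kfac gh.2 p.2 ^- 3 * sfac gh.2 p.2)
  * phi (act p gh).

Definition T'_L2 gh (u : H_torus R) : H_torus R :=
  toL2 (torus_measure R) (T' gh u).

End action.

Section subgroups.
Context {R : realType}.
Local Notation M2 := 'M[R]_2.
Implicit Types (F S : set (M2 * M2)) (n m : nat).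

Definition rot (theta : R) : M2 :=
  \matrix_(i < 2, j < 2)
    if i == j then cos theta else if i == 0 then sin theta else - sin theta.

Definition Cn n : set M2 := [set rot (2 * pi * r%:R / n%:R) | r in `I_n].

Definition is_subgroup F n m : Prop :=
  [/\ F `<=` Cn n `*` Cn m, F 1,
      (forall g h, F g -> F h -> F (g * h)) & (forall g, F g -> F g^-1)].

(* cardinality; only used for finite sets *)
Definition set_order F : nat := #|` fset_set F|.

Definition subA : set (M2 * M2) := [set (1, 1); (-1, -1)].
Definition subB : set (M2 * M2) := [set (1, 1); (-1, 1)].
Definition subC : set (M2 * M2) := [set (1, 1); (1, -1)].
Definition subD : set (M2 * M2) := [set (1, 1); (-1, -1); (-1, 1); (1, -1)].

Definition class_O F : Prop := odd (set_order F).
Definition class_E1 F : Prop :=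
  [/\ ~~ odd (set_order F), ~ subD `<=` F & subA `<=` F].
Definition class_E2 F : Prop :=
  [/\ ~~ odd (set_order F), ~ subD `<=` F & subB `<=` F].
Definition class_E3 F : Prop :=
  [/\ ~~ odd (set_order F), ~ subD `<=` F & subC `<=` F].
Definition class_E4 F : Prop := ~~ odd (set_order F) /\ subD `<=` F.

Definition Kgrp : set (M2 * M2) := subD.
Definition K_of F : set (M2 * M2) := Kgrp `&` F.

Definition lcoset (g : M2 * M2) F : set (M2 * M2) := [set g * f | f in F].

(* [s] lists, without repetition, representatives of the cosets of [K_F] in [K]. *)
Definition coset_reps F w (s : 'I_w -> M2 * M2) : Prop :=
  (forall mu, Kgrp (s mu)) /\
  (forall k, Kgrp k -> exists! mu, lcoset (s mu) (K_of F) k).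

(* both divisions are exact when [F] is a subgroup of [C_n x C_m] *)
Definition omega F : nat := (set_order Kgrp %/ set_order (K_of F))%N.
Definition theta n m F : nat :=
  ((set_order (Cn n `*` Cn m) * set_order (K_of F))
   %/ (set_order F * set_order Kgrp))%N.

Definition admissible n m F S : Prop :=
  exists (g : 'I_(theta n m F) -> M2 * M2)
         (s : 'I_(theta n m F) -> 'I_(omega F) -> M2 * M2),
  [/\ forall nu, (Cn n `*` Cn m) (g nu),
      forall nu, coset_reps F (s nu),
      forall (la nu : 'I_(theta n m F)) mu, (la < nu)%N ->
        ~ lcoset (g la * s la mu) F (g nu)
    & S = [set h | exists nu mu, h = g nu * s nu mu] ].

Definition Fnm n m : set (P1 R * P1 R) :=
  [set (angle rho, angle sigma) |
     rho in `]0, 4 * pi / n%:R[ & sigma in `]0, 4 * pi / m%:R[ ].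

Definition region n m S : set (P1 R * P1 R) :=
  \bigcup_(s in S) [set act p s | p in Fnm n m].

End subgroups.

Section measurability.
Context {R : realType}.
Local Notation M2 := 'M[R]_2.

Lemma mobius_angle_rot (rho t : R) :
  mobius (angle rho) (rot t) = angle (rho + 2 * t).
Proof.
rewrite /mobius /mnum /mden /rot !mxE /= /angle.
have -> : (rho + 2 * t) / 2 = rho / 2 + t by field.
rewrite sinD cosD; have := cos2Dsin2 (rho / 2).
set a := cos (rho / 2); set b := sin (rho / 2).
have [b0|b0] := eqVneq b 0 => /= ab.
  have a0 : a != 0.
    by apply: contra_eq_neq ab => ->; rewrite b0; lra.
  rewrite b0 !mul0r !addr0 add0r !mul1r subr0 mulf_eq0 (negbTE a0) /=.
  case: ifPn => // t0; congr Some; field; exact/andP.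
have -> : a / b * sin t + 1 * cos t = (b * cos t + a * sin t) / b by field.
rewrite mulf_eq0 invr_eq0 (negbTE b0) orbF.
by case: ifPn => // c0; congr Some; field; apply/andP.
Qed.

Lemma rotD (s t : R) : rot s * rot t = rot (s + t).
Proof.
apply/matrixP => i j; rewrite /rot !mxE !big_ord_recl big_ord0 !mxE sinD cosD.
by case: (unliftP 0 i) => [i'|] ->; case: (unliftP 0 j) => [j'|] ->;
  rewrite ?(ord1 i') ?(ord1 j') /=; ring.
Qed.

Lemma measurable_angle_image (U : set R) : open U -> measurable (angle @` U).
Proof.
move=> oU; apply: open_measurable.
rewrite openE => t /= [r Ur rt]; rewrite /interior.
move: oU; rewrite openE => /(_ _ Ur); rewrite /interior.
move=> /nbhs_ballP [e /= e0 rU].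
apply/nbhs_ballP; exists e => //= t' tt'; exists (r + (t' - t)).
  by apply: rU; move: tt'; rewrite /ball /= => tt'; rewrite opprD addNKr opprB.
have -> : t' = t + 2 * ((t' - t) / 2) by field.
rewrite -mobius_angle_rot -rt mobius_angle_rot; congr angle.
by field.
Qed.

Lemma measurable_translate n m (a b : R) :
  measurable [set act p (rot a, rot b) | p in Fnm n m].
Proof.
have -> : [set act p (rot a, rot b) | p in Fnm n m] =
    (angle @` `]2 * a, 2 * a + 4 * pi / n%:R[) `*`
    (angle @` `]2 * b, 2 * b + 4 * pi / m%:R[).
  apply/seteqP; split => [_ [_ [r hr] [s hs] <-] <-|[_ _] /=[[r hr <-] [s hs <-]]].
    rewrite /act /= !mobius_angle_rot; split.
      exists (r + 2 * a) => //; move: hr; rewrite /= !in_itv /=.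
      by move=> /andP[? ?]; apply/andP; split; lra.
    exists (s + 2 * b) => //; move: hs; rewrite /= !in_itv /=.
    by move=> /andP[? ?]; apply/andP; split; lra.
  exists (angle (r - 2 * a), angle (s - 2 * b)); last first.
    by rewrite /act /= !mobius_angle_rot !subrK.
  exists (r - 2 * a); last exists (s - 2 * b) => //.
    move: hr; rewrite /= !in_itv /=.
    by move=> /andP[? ?]; apply/andP; split; lra.
  move: hs; rewrite /= !in_itv /=.
  by move=> /andP[? ?]; apply/andP; split; lra.
by apply: measurableX; apply: measurable_angle_image; exact: interval_open.
Qed.

Lemma Kgrp_rot (k : M2 * M2) : Kgrp k -> exists a b, k = (rot a, rot b).
Proof.
have r0 : rot 0 = 1 :> M2.
  apply/matrixP => i j; rewrite /rot !mxE sin0 cos0 oppr0.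
  by case: (i == j) => //; case: (i == 0).
have rpi : rot pi = - 1 :> M2.
  apply/matrixP => i j; rewrite /rot !mxE sinpi cospi oppr0.
  by case: (i == j) => //; rewrite oppr0; case: (i == 0).
by case=> [[[]|]|] ->; [exists 0, 0|exists pi, pi|exists pi, 0|exists 0, pi];
  rewrite ?r0 ?rpi.
Qed.

Lemma measurable_region n m F (S : set (M2 * M2)) :
  admissible n m F S -> measurable (region n m S).
Proof.
move=> [g [s [gG sK _ ->]]].
have -> : region n m [set h | exists nu mu, h = g nu * s nu mu] =
    \bigcup_(i in [set: 'I_(theta n m F) * 'I_(omega F)])
      [set act p (g i.1 * s i.1 i.2) | p in Fnm n m].
  apply/seteqP; split => [p [_ [nu [mu ->]] hp]|p [[nu mu] _ hp]].
    by exists (nu, mu).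
  by exists (g nu * s nu mu) => //; exists nu, mu.
apply: fin_bigcup_measurable => [|[nu mu] _ /=]; first exact: finite_finset.
have [[a _ ga] [b _ gb]] := gG nu.
have [c [d sE]] := Kgrp_rot ((sK nu).1 mu).
have -> : g nu * s nu mu = (rot (2 * pi * a%:R / n%:R + c),
                            rot (2 * pi * b%:R / m%:R + d)).
  by rewrite sE [g nu]surjective_pairing -ga -gb -!rotD.
exact: measurable_translate.
Qed.

End measurability.

Section spaces.
Context {R : realType}.
Local Notation M2 := 'M[R]_2.
Local Notation mu := (torus_measure R).
Implicit Types (F : set (M2 * M2)) (E : set (P1 R * P1 R)).

Definition fixed_space F : set (H_torus R) :=
  [set u | forall h, F h -> T'_L2 h u = u].

Definition supported_in E : set (H_torus R) :=
  [set u | {ae mu, forall p, ~ E p -> (u : P1 R * P1 R -> R) p = 0}].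

(* Its elements are classes, modulo equality almost everywhere on [E],
   of functions that need only be considered on [E]. *)
Definition H_on E (mE : measurable E) := LspaceType2 (mrestr mu mE).

Definition extend0 E (mE : measurable E) (u : H_on mE) : H_torus R :=
  toL2 mu (fun p => if p \in E then (u : P1 R * P1 R -> R) p else 0).

Definition restrict_to E (mE : measurable E) (u : H_torus R) : H_on mE :=
  toL2 (mrestr mu mE) u.

Definition sigma_map F (u : H_torus R) : H_torus R :=
  toL2 mu (fun p => (set_order (K_of F))%:R^-1 * \sum_(g \in F) T' g u p).

Definition rho_map E (u : H_torus R) : H_torus R :=
  toL2 mu (\1_E \* (u : P1 R * P1 R -> R)).

End spaces.

Definition inverse_bijections (X Y : Type) (A : set X) (B : set Y)
    (f : X -> Y) (g : Y -> X) : Prop :=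
  [/\ set_fun A B f, set_fun B A g,
      forall x, A x -> g (f x) = x & forall y, B y -> f (g y) = y].

(* Main.v *)
Require Import Defs.
From HB Require Import structures.
From mathcomp Require Import all_boot all_order all_algebra finmap.
From mathcomp Require Import all_classical all_reals all_analysis.
From mathcomp Require Import measurable_realfun ring lra zify.
Import Order.TTheory GRing.Theory Num.Theory.
Import numFieldNormedType.Exports.

(** A rotation by [t] shifts the angular coordinate by [2 t], has [kfac = 1],
    and enters [T'] only through the sign [sfac].  Cut the circle at the
    multiples of [4 pi / n]: the open arcs that remain are permuted by [Cn n],
    and since [n] is even the point at infinity is one of the cuts, so that
    [sfac] is an exact cocycle on the arcs.  The cuts are negligible
    ([ae_generic]) and rotations preserve the measure ([torus_measure_act]);
    hence [T'] is, off a null set, a representation of the group C_n x C_m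
    ([T'M]), and it preserves square integrability ([Lfun2_T']).

    In this representation (-1, 1) and (1, -1) act as - id.  If [F] contains one
    of them, which is the case in the classes E_2, E_3 and E_4, a fixed function
    equals its opposite and vanishes ([fixed_space_trivial]).

    In the classes O and E_1, K_F is contained in {1, (-1, -1)}
    ([K_of_diag]), which acts trivially on functions.  Products of arcs
    correspond to the cosets of K in C_n x C_m, and the elements [g nu] of an
    admissible choice represent the cosets of K F: they are inequivalent by
    construction, and their number leaves no room for a further coset
    ([coset_cover]).  So the region [E] meets almost every orbit of [F]
    ([region_meets_orbit]), and two points of [E] in the same orbit differ by
    an element of K_F ([region_stab]).  By the first fact a fixed function is
    determined by its restriction to [E] ([fixed_space_eq]).  By the second one,
    if [w] vanishes outside [E], then the sum over [F] has on [E] only the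
    |K_F| nonzero terms coming from K_F, each equal to [w], so that averaging
    gives back [w] on [E] ([average_region]).  The bijections follow from these
    two facts. *)

Set Implicit Arguments.
Unset Strict Implicit.
Unset Printing Implicit Defensive.

Local Open Scope classical_set_scope.
Local Open Scope ring_scope.

(* The same name also denotes the rotation of sequences. *)
Local Notation rot := Defs.rot.

(** * Square integrable functions *)

Section square_integrable.
Context d (T : measurableType d) (R : realType) (mu : {measure set T -> \bar R}).
Implicit Types (f g h : T -> R) (u : LspaceType2 mu).

Lemma aeP f g : f = g %[ae mu] <-> {ae mu, forall x, f x = g x}.
Proof. by split; apply: filterS => x; [apply|move=> ->]. Qed.

(** Trades the norm for the integral of a square, to which comparison and
    change of variables apply. *)
Lemma Lfun2P f : f \in Lfun mu 2%:E <->
  measurable_fun setT f /\ (\int[mu]_x (f x ^+ 2)%:E < +oo)%E.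
Proof.
split=> [fL|[mf fi]].
  split; first by move: (sub_Lfun_mfun fL); rewrite inE.
  have /integrableP[_] := Lfun2_integrable_sqr fL.
  by under eq_integral do rewrite /= ger0_norm ?sqr_ge0//.
apply/andP; split; rewrite inE//= /finite_norm unlock poweR_lty//.
under eq_integral => x _ do rewrite /= powR_mulrn// -normrX ger0_norm ?sqr_ge0//.
exact: fi.
Qed.

Lemma measurable_Lfun2 f : f \in Lfun mu 2%:E -> measurable_fun setT f.
Proof. by case/Lfun2P. Qed.

Lemma Lfun2_le f h : measurable_fun setT h -> (forall x, `|h x| <= `|f x|) ->
  f \in Lfun mu 2%:E -> h \in Lfun mu 2%:E.
Proof.
move=> mh hf /Lfun2P[mf fi]; apply/Lfun2P; split => //.
apply: le_lt_trans fi; apply: ge0_le_integral => //.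
- by move=> x _; rewrite lee_fin sqr_ge0.
- by apply/measurable_EFinP; exact: measurable_funX.
- by apply/measurable_EFinP; exact: measurable_funX.
- by move=> x _; rewrite lee_fin -[h x ^+ 2]real_normK ?num_real//
    -[f x ^+ 2]real_normK ?num_real// lerXn2r ?nnegrE.
Qed.

Lemma Lfun2_sum (I : eqType) (r : seq I) (F : I -> T -> R) :
  {in r, forall i, F i \in Lfun mu 2%:E} ->
  (fun x => \sum_(i <- r) F i x) \in Lfun mu 2%:E.
Proof.
elim: r => [_|i r IH FL].
  under eq_fun do rewrite big_nil.
  exact: (LfunP (cst 0 : LfunType mu (@lee1n R 2))).
under eq_fun do rewrite big_cons.
have [_ LD] := @Lfun_addr_closed _ _ _ mu 2%:E (lee1n 2).
apply: LD; first by apply: FL; rewrite mem_head.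
by apply: IH => j jr; apply: FL; rewrite inE jr orbT.
Qed.

Lemma Lspace_Lfun2 u : (u : T -> R) \in Lfun mu 2%:E.
Proof.
case: u => u [[/= hu]]; apply/andP; split; rewrite inE //=.
exact: (@measurable_funPT _ _ _ _ (repr u)).
Qed.

Lemma toL2_eq f g : f \in Lfun mu 2%:E -> g \in Lfun mu 2%:E ->
  {ae mu, forall x, f x = g x} -> toL2 mu f = toL2 mu g.
Proof.
move=> fL gL fg; apply/L2_eqP.
apply: ae_eq_trans (toL2_ae fL) _; apply: ae_eq_trans (ae_eq_sym (toL2_ae gL)).
exact/aeP.
Qed.

Lemma toL2K u : toL2 mu u = u.
Proof. by apply/L2_eqP; apply: toL2_ae; exact: Lspace_Lfun2. Qed.

Lemma ae_toL2 f : f \in Lfun mu 2%:E -> {ae mu, forall x, (toL2 mu f : T -> R) x = f x}.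
Proof. by move=> fL; apply/aeP; exact: toL2_ae. Qed.

Section preserving.
Variable s : T -> T.
Hypothesis ms : measurable_fun setT s.
Hypothesis mus : forall A, measurable A -> mu (s @^-1` A) = mu A.

Lemma ae_comp (P : T -> Prop) :
  {ae mu, forall x, P x} -> {ae mu, forall x, P (s x)}.
Proof.
move=> [N [mN N0 PN]]; exists (s @^-1` N); split.
- by rewrite -[X in measurable X]setTI; exact: ms.
- by rewrite mus.
- by move=> x Px; apply: PN.
Qed.

Lemma Lfun2_comp f : f \in Lfun mu 2%:E -> f \o s \in Lfun mu 2%:E.
Proof.
move=> /Lfun2P[mf fi]; apply/Lfun2P; split; first exact: measurableT_comp.
have mf2 : measurable_fun setT (fun x => (f x ^+ 2)%:E).
  by apply/measurable_EFinP; exact: measurable_funX.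
have := @ge0_integral_pushforward _ _ _ _ _ _ ms mu setT (fun x => (f x ^+ 2)%:E)
  measurableT mf2.
rewrite preimage_setT => <-; last by move=> x _; rewrite lee_fin sqr_ge0.
rewrite (@eq_measure_integral _ _ _ _ mu)// => A mA _.
exact: mus.
Qed.

End preserving.
End square_integrable.

Section restriction.
Context d (T : measurableType d) (R : realType) (mu : {measure set T -> \bar R}).
Variables (E : set T) (mE : measurable E).
Local Notation muE := (mrestr mu mE).

(** The complement of [E] is null for the restricted measure, so it may be added
    to the exceptional set. *)
Lemma ae_mrestr (P : T -> Prop) :
  {ae muE, forall x, P x} <-> {ae mu, forall x, E x -> P x}.
Proof.
split=> [[N [mN N0 PN]]|[N [mN N0 PN]]].
  exists (N `&` E); split; [exact: measurableI|exact: N0|].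
  move=> x /= /not_implyP[Ex Px]; split => //; exact: PN.
exists (N `|` ~` E); split; first by apply: measurableU => //; exact: measurableC.
  rewrite /= /mrestr setIUl setICl setU0; apply/eqP.
  by rewrite -measure_le0 -N0 le_measure ?inE//; exact: measurableI.
move=> x /= Px; have [Ex|] := pselect (E x); last by right.
by left; apply: PN => /= /(_ Ex).
Qed.

Lemma Lfun2_restrict (f : T -> R) :
  f \in Lfun mu 2%:E -> f \in Lfun muE 2%:E.
Proof.
move=> /Lfun2P[mf fi]; apply/Lfun2P; split => //; apply: le_lt_trans fi.
apply: ge0_le_measure_integral => //.
- by move=> S mS; rewrite /= /mrestr le_measure ?inE//; exact: measurableI.
- by move=> x; rewrite lee_fin sqr_ge0.
- by apply/measurable_EFinP; exact: measurable_funX.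
Qed.

(** The integral splits along [E] and its complement, where the integrand
    vanishes. *)
Lemma Lfun2_extend (f : T -> R) :
  f \in Lfun muE 2%:E -> f \* \1_E \in Lfun mu 2%:E.
Proof.
move=> /Lfun2P[mf fi]; apply/Lfun2P.
have mfE : measurable_fun setT (f \* \1_E) by exact: measurable_funM.
have mfE2 : measurable_fun setT (fun x => ((f \* \1_E) x ^+ 2)%:E).
  by apply/measurable_EFinP; exact: measurable_funX.
have fE0 x : setT x -> (0 <= ((f \* \1_E) x ^+ 2)%:E)%E.
  by rewrite lee_fin sqr_ge0.
split => //.
have mEC : measurable (~` E) by exact: measurableC.
rewrite (@eq_measure_integral _ _ _ _ (measure_add muE (mrestr mu mEC))); last first.
  move=> A mA _; apply/esym; etransitivity; first exact: measure_addE.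
  rewrite /= /mrestr -measureU//.
  - by rewrite -setIUr setUCr setIT.
  - exact: measurableI.
  - exact: measurableI.
  - by rewrite setIACA setICr setI0.
rewrite ge0_integral_measure_add//.
rewrite [X in (_ + X)%E](_ : _ = 0%E) ?adde0.
  apply: le_lt_trans fi; apply: ge0_le_integral => //.
    by apply/measurable_EFinP; exact: measurable_funX.
  move=> x _; rewrite lee_fin /= indicE.
  by case: (x \in E); rewrite ?mulr1// mulr0 expr0n/= sqr_ge0.
rewrite -(integral0 (mrestr mu mEC) setT); apply: ae_eq_integral => //.
exists E; split => //; first by rewrite /= /mrestr setICr measure0.
move=> x /=; apply: contra_notP => Ex _.
by rewrite indicE memNset// mulr0 expr0n.
Qed.
End restriction.

(** * Angles *)

Section circle.
Context {R : realType}.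
Local Notation lam := (@lebesgue_measure R).

(** Lebesgue measure is determined by its values on half-open intervals, whose
    length is invariant. *)
Lemma lebesgue_measure_translate (c : R) (A : set R) : measurable A ->
  lam ((fun x => x + c) @^-1` A) = lam A.
Proof.
move=> mA.
have ms : measurable_fun [set: measurableTypeR R]
    (fun x : R => (x + c : measurableTypeR R)).
  exact: measurable_funD.
pose sh : {mfun measurableTypeR R >-> measurableTypeR R} := HB.pack (fun x : R => x + c)
  (isMeasurableFun.Build _ _ _ _ _ ms).
apply/esym/(@lebesgue_measure_unique R (pushforward lam sh) _ A mA) => _ [[a b]] _ <-.
rewrite [RHS](_ : _ = lam `]a - c, b - c]%classic); last first.
  congr (lam _); apply/seteqP.
  by split => x /=; rewrite !in_itv/= ltrBlDr lerBrDr.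
rewrite !lebesgue_measure_itv/= !lte_fin ltrD2r; case: ifP => // _.
by rewrite -!EFinB; congr EFin; ring.
Qed.

Lemma angle_nat2pi (rho : R) (k : nat) : angle (rho + 2 * pi * k%:R) = angle rho.
Proof.
elim: k rho => [|k IH] rho; first by rewrite mulr0 addr0.
rewrite -[k.+1%:R]natr1 mulrDr addrA mulr1 -[RHS]IH /angle.
set x := rho + _; have -> : (x + 2 * pi) / 2 = x / 2 + pi by field.
by rewrite sinDpi cosDpi oppr_eq0 invrN mulrNN.
Qed.

Lemma angle_int2pi (rho : R) (k : int) : angle (rho + 2 * pi * k%:~R) = angle rho.
Proof.
case: (intP k) => [|i|i]; first by rewrite mulr0 addr0.
  exact: angle_nat2pi.
by rewrite -(angle_nat2pi _ i.+1) intrN mulrN subrK.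
Qed.

(** Reduce modulo [pi] to an angle in [[0, pi[], where only 0 is a zero of the
    sine. *)
Lemma sin_eq0_int (x : R) : sin x = 0 -> exists k : int, x = pi * k%:~R.
Proof.
move=> x0; pose k := Num.floor (x / pi); exists k.
have pi0 := pi_gt0 R.
have kpi (y : R) (l : nat) : `|sin (y + pi * l%:R)| = `|sin y|.
  elim: l => [|l IH]; first by rewrite mulr0 addr0.
  by rewrite -[l.+1%:R]natr1 mulrDr addrA mulr1 sinDpi normrN.
have e0 : sin (x - pi * k%:~R) = 0.
  apply/normr0_eq0; case: (intP k) => [|l|l]; first by rewrite mulr0 subr0 x0 normr0.
    by rewrite -(kpi _ l.+1) subrK x0 normr0.
  by rewrite intrN mulrN opprK kpi x0 normr0.
apply/eqP; rewrite -subr_eq0 eq_le leNgt; apply/andP; split.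
  apply/negP => lt0; have /sin_gt0_pi : 0 < x - pi * k%:~R < pi.
    rewrite lt0/= ltrBlDr -[X in _ < X + _]mulr1 -mulrDr.
    by rewrite -ltr_pdivrMl// mulrC addrC -[1]/(1%:~R) -intrD floorD1_gt.
  by rewrite e0 ltxx.
by rewrite subr_ge0 -ler_pdivlMl// mulrC floor_le.
Qed.

(** Equal cotangents at [a / 2] and [b / 2] give sin ((a - b) / 2) = 0. *)
Lemma angle_eq (a b : R) : angle a = angle b -> exists k : int, a = b + 2 * pi * k%:~R.
Proof.
move=> ab; have [k hk] : exists k : int, (a - b) / 2 = pi * k%:~R.
  apply: sin_eq0_int; rewrite mulrBl sinB.
  move: ab; rewrite /angle; case: eqP => [->|/eqP a0]; case: eqP => [->|/eqP b0]//.
    by move=> _; rewrite mul0r mulr0 subr0.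
  move=> [] /(congr1 (fun x => x * (sin (a / 2) * sin (b / 2)))) e.
  apply/eqP; rewrite subr_eq0; apply/eqP.
  transitivity (cos (b / 2) / sin (b / 2) * (sin (a / 2) * sin (b / 2))); first by field.
  by rewrite -e; field.
by exists k; rewrite -mulrA -hk; field.
Qed.

End circle.

(** * Rotations preserve the measure of the torus *)

Section invariance.
Context {R : realType}.
Local Notation lam := (@lebesgue_measure R).
Local Notation pi := (@pi R).

(** The Borel structure of [P1 R] is the final one for [angle]. *)
Lemma measurable_P1 (f : P1 R -> R) :
  measurable_fun setT (f \o angle) -> measurable_fun setT f.
Proof. by move=> mf _ B mB; have := mf measurableT B mB; rewrite !setTI. Qed.

Lemma measurable_mobius_rot (t : R) :
  measurable_fun setT (fun x : P1 R => mobius x (rot t)).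
Proof.
move=> _ A mA; rewrite setTI /measurable /= /P1_measurable /=.
have -> : angle @^-1` ((fun x => mobius x (rot t)) @^-1` A) =
    (fun r => r + 2 * t) @^-1` (angle @^-1` A).
  by apply/seteqP; split => r /=; rewrite mobius_angle_rot.
have ms : measurable_fun setT (fun r : R => r + 2 * t) by exact: measurable_funD.
by have := ms measurableT _ mA; rewrite setTI.
Qed.

(** Translation by [c] turns the window into [[c, c + 2 pi[]; periodicity brings
    the part of it beyond [2 pi] to [[0, c[]. *)
Lemma lebesgue_measure_window (B : set R) (c : R) :
  measurable B -> (forall r, B (r + 2 * pi) <-> B r) -> 0 <= c < 2 * pi ->
  lam ((fun r => r + c) @^-1` B `&` `[0, 2 * pi[) = lam (B `&` `[0, 2 * pi[).
Proof.
move=> mB perB /andP[c0 c2].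
have mBi (i : interval R) : measurable (B `&` [set` i]).
  by apply: measurableI => //; exact: measurable_itv.
have -> : (fun r => r + c) @^-1` B `&` `[0, 2 * pi[ =
          (fun r => r + c) @^-1` (B `&` `[c, c + 2 * pi[).
  apply/seteqP; split => r [Br]; rewrite /= !in_itv/= => /andP[? ?].
    by split => //=; rewrite ?in_itv/=; apply/andP; split; lra.
  by split => //=; rewrite ?in_itv/=; apply/andP; split; lra.
have -> : B `&` `[c, c + 2 * pi[ =
    (B `&` `[c, 2 * pi[) `|` (B `&` `[2 * pi, c + 2 * pi[).
  rewrite -setIUr; congr (_ `&` _); apply/seteqP; split => r /=; rewrite !in_itv/=.
    by move=> /andP[cr r2]; have [?|?] := ltP r (2 * pi); [left|right];
      apply/andP; split.
  by case=> /andP[? ?]; apply/andP; split; lra.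
have -> : B `&` `[0, 2 * pi[ = (B `&` `[c, 2 * pi[) `|` (B `&` `[0, c[).
  rewrite -setIUr; congr (_ `&` _); apply/seteqP; split => r /=; rewrite !in_itv/=.
    by move=> /andP[cr r2]; have [?|?] := leP c r; [left|right];
      apply/andP; split.
  by case=> /andP[? ?]; apply/andP; split; lra.
rewrite lebesgue_measure_translate; last by apply: measurableU.
have disj (i j : interval R) : [set` i] `&` [set` j] = set0 ->
    (B `&` [set` i]) `&` (B `&` [set` j]) = set0.
  by move=> ij; rewrite setIACA ij setI0.
rewrite !measureU; try exact: mBi.
- congr (_ + _)%E; apply: eq_trans.
    by apply/esym/(lebesgue_measure_translate (2 * pi)).
  congr (lam _); apply/seteqP; split => r [Br]; rewrite /= !in_itv/= => /andP[? ?].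
    by split; [exact/perB|rewrite /= ?in_itv/=; apply/andP; split; lra].
  by split; [exact/perB|rewrite /= ?in_itv/=; apply/andP; split; lra].
- apply: disj; apply/seteqP; split => r //= [].
  by rewrite !in_itv/= => /andP[? ?] /andP[? ?]; lra.
- apply: disj; apply/seteqP; split => r //= [].
  by rewrite !in_itv/= => /andP[? ?] /andP[? ?]; lra.
Qed.

(** Since [angle] has period [2 pi], the shift [2 t] may be reduced modulo
    [2 pi], to fall in the range of [lebesgue_measure_window]. *)
Lemma P1_measure_rot (t : R) (A : set (P1 R)) : measurable A ->
  P1_measure R ((fun x => mobius x (rot t)) @^-1` A) = P1_measure R A.
Proof.
move=> mA; rewrite /P1_measure /pushforward /mrestr.
have pi0 : 0 < 2 * pi by rewrite mulr_gt0// pi_gt0.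
pose k := Num.floor (2 * t / (2 * pi)); pose c := 2 * t - 2 * pi * k%:~R.
rewrite -(@lebesgue_measure_window (angle @^-1` A) c)//.
- congr (lam (_ `&` _)); apply/seteqP; split => r /=; rewrite mobius_angle_rot.
    by rewrite -(angle_int2pi (r + c) k) /c addrA subrK.
  by rewrite -(angle_int2pi (r + c) k) /c addrA subrK.
- by move=> r /=; have := angle_nat2pi r 1; rewrite mulr1 => ->.
- rewrite /c subr_ge0 ltrBlDr -ler_pdivlMl// mulrC floor_le/=.
  by rewrite -[X in _ < X + _]mulr1 -mulrDr -ltr_pdivrMl// mulrC addrC
    -[1]/(1%:~R) -intrD floorD1_gt.
Qed.

Lemma measurable_act (a b : R) :
  measurable_fun setT (fun p : P1 R * P1 R => act p (rot a, rot b)).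
Proof.
apply/measurable_fun_pairP; split => /=.
  exact: measurableT_comp (measurable_mobius_rot a) measurable_fst.
exact: measurableT_comp (measurable_mobius_rot b) measurable_snd.
Qed.

(** A product measure is determined by its values on rectangles. *)
Lemma torus_measure_act (a b : R) (A : set (P1 R * P1 R)) : measurable A ->
  torus_measure R ((fun p => act p (rot a, rot b)) @^-1` A) = torus_measure R A.
Proof.
move=> mA.
pose sh : {mfun (P1 R * P1 R)%type >-> (P1 R * P1 R)%type} := HB.pack
  (fun p : P1 R * P1 R => act p (rot a, rot b))
  (isMeasurableFun.Build _ _ _ _ _ (measurable_act a b)).
apply/esym.
apply: (@product_measure_unique _ _ _ _ R (P1_measure R) (P1_measure R)
  (pushforward (torus_measure R) sh)) => // A1 A2 mA1 mA2.
have mpre (t : R) (B : set (P1 R)) : measurable B ->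
    measurable ((fun x => mobius x (rot t)) @^-1` B).
  by move=> mB; rewrite -[X in measurable X]setTI; exact: measurable_mobius_rot.
have := product_measure1E (P1_measure R) (P1_measure R) (mpre a _ mA1) (mpre b _ mA2).
by rewrite /= !P1_measure_rot.
Qed.

End invariance.

(** * Rotations and cells *)

Section rotations.
Context {R : realType}.
Local Notation pi := (@pi R).
Local Notation M2 := 'M[R]_2.

Lemma rot_zero : rot 0 = 1 :> M2.
Proof.
apply/matrixP => i j; rewrite !mxE sin0 cos0 oppr0.
by case: (i == j) => //; case: (i == 0).
Qed.

Lemma rot_pi : rot pi = - 1 :> M2.
Proof.
apply/matrixP => i j; rewrite !mxE sinpi cospi oppr0.
by case: (i == j) => //; rewrite oppr0; case: (i == 0).
Qed.

Lemma rot_nat2pi (t : R) (k : nat) : rot (t + 2 * pi * k%:R) = rot t.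
Proof.
rewrite -Defs.rotD; elim: k => [|k IH]; first by rewrite mulr0 rot_zero mulr1.
rewrite -[k.+1%:R]natr1 mulrDr mulr1 -Defs.rotD mulrA IH.
have -> : 2 * pi = pi + pi by ring.
by rewrite -Defs.rotD rot_pi mulrNN !mulr1.
Qed.

Variables (n : nat).
Hypotheses (n_gt0 : (0 < n)%N) (n_even : ~~ odd n).

Lemma Cn_rot (r : nat) : Cn n (rot (2 * pi * r%:R / n%:R) : M2).
Proof.
have n0 : n%:R != 0 :> R by rewrite pnatr_eq0 -lt0n.
exists (r %% n)%N; first by rewrite /= ltn_mod.
have e : r%:R = (r %/ n)%:R * n%:R + (r %% n)%:R :> R by rewrite -natrM -natrD -divn_eq.
by rewrite -(rot_nat2pi _ (r %/ n)) [in RHS]e; congr rot; field.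
Qed.

Lemma CnP (g : M2) :
  Cn n g -> exists2 r : nat, (r < n)%N & g = rot (2 * pi * r%:R / n%:R).
Proof. by move=> [r rn <-]; exists r. Qed.

Lemma CnM (g h : M2) : Cn n g -> Cn n h -> Cn n (g * h).
Proof.
move=> /CnP[r _ ->] /CnP[s _ ->]; rewrite Defs.rotD.
have -> : 2 * pi * r%:R / n%:R + 2 * pi * s%:R / n%:R = 2 * pi * (r + s)%:R / n%:R.
  by rewrite natrD; ring.
exact: Cn_rot.
Qed.

Lemma Cn1 : Cn n (1 : M2).
Proof. by have := Cn_rot 0; rewrite mulr0 mul0r rot_zero. Qed.

Lemma CnN1 : Cn n (-1 : M2).
Proof.
have := Cn_rot n./2; congr Cn; rewrite -rot_pi; congr rot.
have n0 : n%:R != 0 :> R by rewrite pnatr_eq0 -lt0n.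
have e : n%:R = 2 * (n./2)%:R :> R by rewrite -natrM mul2n even_halfK.
by apply: (mulIf n0); rewrite mulfVK// e; ring.
Qed.

Lemma mulrC_Cn (g h : M2) : Cn n g -> Cn n h -> g * h = h * g.
Proof. by move=> /CnP[r _ ->] /CnP[s _ ->]; rewrite !Defs.rotD addrC. Qed.

Lemma Cn_inv (g : M2) : Cn n g -> exists2 h, Cn n h & g * h = 1.
Proof.
move=> /CnP[r rn ->]; exists (rot (2 * pi * (n - r)%:R / n%:R)); first exact: Cn_rot.
have n0 : n%:R != 0 :> R by rewrite pnatr_eq0 -lt0n.
rewrite Defs.rotD natrB ?(ltnW rn)// -rot_zero -(rot_nat2pi 0 1); congr rot; by field.
Qed.

(** The index is unbounded, so that a rotation by [r] steps is [i |-> i + r]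
    without reduction; cells that differ by a full turn have the same image
    under [angle]. *)
Definition cell (i : nat) : set R :=
  `]4 * pi * i%:R / n%:R, 4 * pi * i.+1%:R / n%:R[.

Definition generic1 : set (P1 R) := \bigcup_i (angle @` cell i).

Lemma cell0 : cell 0 = `]0, 4 * pi / n%:R[%classic.
Proof. by rewrite /cell mulr0 mul0r mulr1. Qed.

Lemma generic1_Cn (x : P1 R) g : Cn n g -> generic1 x -> generic1 (mobius x g).
Proof.
move=> /CnP[r rn ->] [i _ [rho hrho <-]].
rewrite mobius_angle_rot; exists (i + r)%N => //.
exists (rho + 2 * (2 * pi * r%:R / n%:R)) => //; move: hrho.
rewrite /cell /= !in_itv/= => /andP[h1 h2]; rewrite -addSn !natrD.
apply/andP; split.
  apply: le_lt_trans (_ : 4 * pi * i%:R / n%:R + 2 * (2 * pi * r%:R / n%:R) < _).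
    by rewrite le_eqVlt; apply/orP; left; apply/eqP; ring.
  by rewrite ltrD2r.
apply: lt_le_trans (_ : 4 * pi * i.+1%:R / n%:R + 2 * (2 * pi * r%:R / n%:R) <= _).
  by rewrite ltrD2r.
by rewrite le_eqVlt; apply/orP; left; apply/eqP; ring.
Qed.

Lemma angle_None (rho : R) : angle rho = None -> exists k : int, rho = 2 * pi * k%:~R.
Proof.
rewrite /angle; case: eqP => // /sin_eq0_int [k hk] _; exists k.
by rewrite -[LHS](@divfK _ 2)// hk; ring.
Qed.

(** Infinity has the angular coordinates [2 pi k = 4 pi (k n / 2) / n]: these
    are cuts because [n] is even. *)
Lemma generic1_neq_None (x : P1 R) : generic1 x -> x <> None.
Proof.
move=> [i _ [rho hrho <-]] /angle_None[k rhoE]; move: hrho.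
rewrite rhoE /cell /= in_itv/=.
have n0 : 0 < n%:R :> R by rewrite ltr0n.
have pi0 := pi_gt0 R.
have e : n%:R = 2 * (n./2)%:R :> R by rewrite -natrM mul2n even_halfK.
rewrite ltr_pdivrMr// ltr_pdivlMr// e.
have -> : 2 * pi * k%:~R * (2 * n./2%:R) = 4 * pi * (k * n./2%:Z)%:~R.
  by rewrite intrM; ring.
rewrite !ltr_pM2l ?mulr_gt0// -[i%:R]/(i%:Z%:~R) -[i.+1%:R]/(i.+1%:Z%:~R) !ltr_int.
by lia.
Qed.

Lemma mobius_to_cell0 (x : P1 R) : generic1 x ->
  exists2 g, Cn n g & exists2 rho, (cell 0) rho & mobius x g = angle rho.
Proof.
move=> [i _ [rho hrho <-]].
have n0 : n%:R != 0 :> R by rewrite pnatr_eq0 -lt0n.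
(* Modulo [n] steps, going back by [i] is going forward by [(n - 1) i]. *)
pose r := ((n - 1) * i)%N.
exists (rot (2 * pi * r%:R / n%:R)); first exact: Cn_rot.
exists (rho - 4 * pi * i%:R / n%:R).
  move: hrho; rewrite /cell /= !in_itv/= mulr0 mul0r subr_gt0 => /andP[-> h2] /=.
  rewrite ltrBlDr; apply: lt_le_trans h2 _; rewrite -natr1.
  by rewrite le_eqVlt; apply/orP; left; apply/eqP; field.
rewrite mobius_angle_rot -(angle_nat2pi (rho - _) (2 * i)); congr angle.
by rewrite /r natrM natrB// natrM; field.
Qed.

(** Modulo [2 pi], the shift [4 pi r / n] is less than [4 pi / n] in absolute
    value, that is |r - k n / 2| < 1 for some [k]: hence r = 0 or r = n / 2. *)
Lemma cell0_rot (a b : R) g : cell 0 a -> cell 0 b -> Cn n g ->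
  mobius (angle a) g = angle b -> g = 1 \/ g = -1.
Proof.
have n0 : 0 < n%:R :> R by rewrite ltr0n.
have pi0 := pi_gt0 R.
move=> + + /CnP[r rn ->]; rewrite cell0 /= !in_itv /= => /andP[a0 a1] /andP[b0 b1].
rewrite mobius_angle_rot => /angle_eq[k].
have e : n%:R = 2 * (n./2)%:R :> R by rewrite -natrM mul2n even_halfK.
move=> hk; have {}hk : a * n%:R + 4 * pi * (r%:Z - k * (n./2)%:Z)%:~R = b * n%:R.
  have -> : b = a + 2 * (2 * pi * r%:R / n%:R) - 2 * pi * k%:~R by rewrite hk addrK.
  rewrite intrB intrM -!pmulrn e.
  have h0 : (n./2)%:R != 0 :> R by apply: contraTneq n0 => h; rewrite e h mulr0 ltxx.
  by field.
rewrite ltr_pdivlMr// in a1; rewrite ltr_pdivlMr// in b1.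
have {a0}a0 : 0 < a * n%:R by rewrite mulr_gt0.
have {b0}b0 : 0 < b * n%:R by rewrite mulr_gt0.
have hz : r%:Z = k * (n./2)%:Z.
  apply/eqP; rewrite -subr_eq0; move: hk; set z := r%:Z - _ => hk.
  have : (-1 < z%:~R :> R) && (z%:~R < 1 :> R).
    rewrite -(ltr_pM2l (_ : 0 < 4 * pi)) ?mulr_gt0// mulrN1.
    rewrite -[X in _ && X](ltr_pM2l (_ : 0 < 4 * pi)) ?mulr_gt0// mulr1.
    by apply/andP; split; lra.
  rewrite -[-1]/((-1)%:~R) -[1]/(1%:~R) !ltr_int => ?; lia.
have [->|rn2] : r = 0%N \/ r = n./2.
  have n2 : (n = 2 * n./2)%N by rewrite mul2n even_halfK.
  have /andP[k_ge0 k_lt2] : (0 <= k) && (k < 2) by apply/andP; split; nia.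
  have [k0|k1] : k = 0 \/ k = 1 by lia.
    by left; move: hz; rewrite k0 mul0r => -[].
  by right; move: hz; rewrite k1 mul1r => -[].
  by left; rewrite mulr0 mul0r rot_zero.
right; rewrite rn2 -rot_pi; congr rot; apply: (mulIf (lt0r_neq0 n0)).
by rewrite mulfVK ?gt_eqF// e; ring.
Qed.

End rotations.

(** * The multiplier of a rotation *)

Section multiplier.
Context {R : realType}.
Local Notation pi := (@pi R).
Local Notation M2 := 'M[R]_2.
Implicit Types (x : P1 R) (g h : M2).

Lemma kfac_rot (t : R) x : kfac (rot t) x = 1.
Proof.
rewrite /kfac /mden /mnum /rot !mxE /=.
set a := (homog x).1; set b := (homog x).2.
have ab : a ^+ 2 + b ^+ 2 != 0.
  rewrite /a /b; case: x {a b} => [c|] /=; last by rewrite expr1n expr0n addr0 oner_eq0.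
  by rewrite expr1n gt_eqF// ltr_wpDl// sqr_ge0.
rewrite [X in X / _](_ : _ = (a ^+ 2 + b ^+ 2) * (cos t ^+ 2 + sin t ^+ 2)); last by ring.
by rewrite cos2Dsin2 mulr1 divff// sqrtr1.
Qed.

Lemma mden_None g x : mden g x = 0 <-> mobius x g = None.
Proof. by rewrite /mobius; case: eqP. Qed.

(** The sign function is multiplicative and invariant under inversion, which
    spares the division in [sfac]. *)
Lemma sfac_sg g x : sfac g x = Num.sg (mden g x).
Proof.
rewrite /sfac; have [->|d0] := eqVneq (mden g x) 0; first by rewrite mul0r sgr0.
by rewrite {1}[mden g x]numEsg mulfK// normr_eq0.
Qed.

Lemma sfac_le1 g x : `|sfac g x| <= 1.
Proof. by rewrite sfac_sg normr_sg lern1; case: eqP. Qed.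

(** As long as the image of [x] is finite, denominators multiply:
    mden (g h) x = mden g x * mden h (x g). *)
Lemma sfacM (a b : R) x : mobius x (rot a) <> None ->
  sfac (rot a) x * sfac (rot b) (mobius x (rot a)) = sfac (rot a * rot b) x.
Proof.
move=> xg; have /eqP d0 : mden (rot a) x <> 0 by move/mden_None.
have e : mden (rot a * rot b) x = mden (rot a) x * mden (rot b) (mobius x (rot a)).
  rewrite Defs.rotD /mobius (negbTE d0) /=.
  have -> : mden (rot b) (Some (mnum (rot a) x / mden (rot a) x)) =
      mnum (rot a) x / mden (rot a) x * sin b + cos b.
    by rewrite /mden !mxE /= mul1r.
  rewrite mulrDr mulrA (mulrC (mden _ _) (_ / _)) divfK//.
  by rewrite /mden /mnum !mxE /= sinD cosD; ring.
by rewrite !sfac_sg e sgrM.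
Qed.

Lemma mobiusM (a b rho : R) (x := angle rho) :
  mobius (mobius x (rot a)) (rot b) = mobius x (rot a * rot b).
Proof. by rewrite /x Defs.rotD !mobius_angle_rot mulrDr addrA. Qed.

Lemma mobius1 (rho : R) : mobius (angle rho) 1 = angle rho.
Proof. by have := mobius_angle_rot rho 0; rewrite rot_zero mulr0 addr0. Qed.

Lemma mobiusN1 (rho : R) : mobius (angle rho) (-1) = angle rho.
Proof.
have := mobius_angle_rot rho pi; have := angle_nat2pi rho 1.
by rewrite rot_pi mulr1 => ->.
Qed.

Lemma sfac1 x : x <> None -> sfac 1 x = 1.
Proof.
by case: x => // a _; rewrite /sfac /mden /= !mxE /= mulr0 add0r mul1r normr1 divr1.
Qed.

Lemma sfacN1 x : x <> None -> sfac (-1) x = -1.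
Proof.
case: x => // a _.
by rewrite /sfac /mden /= !mxE /= oppr0 mulr0 add0r mul1r normrN normr1 divr1.
Qed.

(** In terms of the angle [r] the denominator is sin (r / 2 + t) / sin (r / 2),
    which has the sign of the product of the two sines. *)
Lemma measurable_sfac_rot (t : R) : measurable_fun setT (sfac (rot t)).
Proof.
apply: measurable_P1.
have msin : measurable_fun setT (fun r : R => sin (r / 2)).
  apply: measurableT_comp; last exact: measurable_funM.
  by apply: continuous_measurable_fun; exact: continuous_sin.
have mcos : measurable_fun setT (fun r : R => cos (r / 2)).
  apply: measurableT_comp; last exact: measurable_funM.
  by apply: continuous_measurable_fun; exact: continuous_cos.
rewrite (_ : _ \o _ = fun r => let v := if sin (r / 2) == 0 then sin t
     else (cos (r / 2) * sin t + sin (r / 2) * cos t) * sin (r / 2) in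
     if 0 < v then 1 else if v < 0 then -1 else 0).
  set v := fun r => if sin (r / 2) == 0 then sin t
     else (cos (r / 2) * sin t + sin (r / 2) * cos t) * sin (r / 2).
  have mv : measurable_fun setT v.
    apply: measurable_fun_ifT => //; first exact: measurable_fun_eqr.
    by apply: measurable_funM => //; apply: measurable_funD; exact: measurable_funM.
  apply: (@measurable_fun_ifT _ _ _ _ _ _ (fun r => 0 < v r)) => //.
    exact: measurable_fun_ltr.
  apply: (@measurable_fun_ifT _ _ _ _ _ _ (fun r => v r < 0)) => //.
  exact: measurable_fun_ltr.
have sgE (v : R) : Num.sg v = if 0 < v then 1 else if v < 0 then -1 else 0.
  by case: sgrP.
apply/funext => r /=; rewrite -sgE sfac_sg /mden /angle !mxE /=.
case: ifPn => [s0|s0] /=; first by rewrite mul1r mul0r addr0.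
rewrite [in RHS]sgrM -[Num.sg (sin (r / 2))]sgrV -sgrM; congr Num.sg; field.
exact: s0.
Qed.

End multiplier.

(** * The representation off a null set *)

Section torus.
Context {R : realType}.
Local Notation pi := (@pi R).
Local Notation M2 := 'M[R]_2.
Local Notation torus := (P1 R * P1 R)%type.
Local Notation mu := (torus_measure R).
Local Notation lam := (@lebesgue_measure R).

Variables (n m : nat).
Hypotheses (n_gt0 : (0 < n)%N) (m_gt0 : (0 < m)%N).
Hypotheses (n_even : ~~ odd n) (m_even : ~~ odd m).
Local Notation G := (Cn n `*` Cn m : set (M2 * M2)).
Implicit Types (p : torus) (g h : M2 * M2) (f : torus -> R).

Definition generic : set torus := generic1 n `*` generic1 m.

Lemma generic_act g p : G g -> generic p -> generic (act p g).
Proof. by move=> [g1 g2] [p1 p2]; split; exact: generic1_Cn. Qed.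

Lemma actM g h p : G g -> G h -> generic p -> act (act p g) h = act p (g * h).
Proof.
move: p g h => [x y] [g1 g2] [h1 h2] [/= /CnP[a _ ->] /CnP[b _ ->]].
move=> [/= /CnP[c _ ->] /CnP[d _ ->]] [/= [i _ [r _ <-]] [j _ [s _ <-]]].
by rewrite /act /= !mobiusM.
Qed.

Lemma act1 p : generic p -> act p 1 = p.
Proof.
move: p => [x y] [/= [i _ [r _ <-]] [j _ [s _ <-]]].
by rewrite /act /= !mobius1.
Qed.

(** The matrix -1 is the rotation by [pi], which moves angles by a full turn. *)
Lemma act_Kgrp k p : Kgrp k -> generic p -> act p k = p.
Proof.
move: p => [x y] + [/= [i _ [r _ <-]] [j _ [s _ <-]]].
by rewrite /act; case=> [[[]|]|] -> /=; rewrite ?mobius1 ?mobiusN1.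
Qed.

Lemma T'E g f p : G g -> T' g f p = sfac g.1 p.1 * sfac g.2 p.2 * f (act p g).
Proof.
move: g => [g1 g2] [/= /CnP[a _ ->] /CnP[b _ ->]].
by rewrite /T' /= !kfac_rot expr1n invr1 !mul1r.
Qed.

(** Generic points have finite generic images, where the signs form a
    cocycle. *)
Lemma T'M g h f p : G g -> G h -> generic p -> T' g (T' h f) p = T' (g * h) f p.
Proof.
move=> Gg Gh gp.
have Ggh : G (g * h).
  by case: Gg => g1 g2; case: Gh => h1 h2; split; exact: CnM.
rewrite !T'E// actM// mulrA; congr (_ * _).
have [/generic1_neq_None ng1 /generic1_neq_None ng2] := generic_act Gg gp.
clear Ggh gp; move: g h Gg Gh ng1 ng2 => [g1 g2] [h1 h2] [/= /CnP[a _ ->] /CnP[b _ ->]].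
move=> [/= /CnP[c _ ->] /CnP[d _ ->]] ng1 ng2.
rewrite -!sfacM; [by ring|exact: ng2|exact: ng1].
Qed.

Lemma T'1 f p : generic p -> T' 1 f p = f p.
Proof.
move=> gp; rewrite T'E; last by split; exact: Cn1.
have [/generic1_neq_None np1 /generic1_neq_None np2] := gp.
rewrite act1//= sfac1; last exact: np1.
by rewrite sfac1 ?mul1r//; exact: np2.
Qed.

Lemma T'N1N1 f p : generic p -> T' (-1, -1) f p = f p.
Proof.
move=> gp; rewrite T'E; last by split; exact: CnN1.
have [/generic1_neq_None np1 /generic1_neq_None np2] := gp.
rewrite act_Kgrp//=; last by left; left; right.
by rewrite sfacN1 ?[sfac (-1) p.2]sfacN1 ?mulrNN ?mul1r//; [exact: np2|exact: np1].
Qed.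

Lemma T'N11 f p : generic p -> T' (-1, 1) f p = - f p.
Proof.
move=> gp; rewrite T'E; last by split; [exact: CnN1|exact: Cn1].
have [/generic1_neq_None np1 /generic1_neq_None np2] := gp.
rewrite act_Kgrp//=; last by left; right.
by rewrite sfacN1 ?sfac1 ?mulr1 ?mulN1r//; [exact: np2|exact: np1].
Qed.

Lemma T'1N1 f p : generic p -> T' (1, -1) f p = - f p.
Proof.
move=> gp; rewrite T'E; last by split; [exact: Cn1|exact: CnN1].
have [/generic1_neq_None np1 /generic1_neq_None np2] := gp.
rewrite act_Kgrp//=; last by right.
by rewrite sfacN1 ?sfac1 ?mul1r ?mulN1r//; [exact: np1|exact: np2].
Qed.

Lemma G_rot g : G g -> exists a b, g = (rot a, rot b).
Proof. by case: g => g1 g2 [/= /CnP[a _ ->] /CnP[b _ ->]]; do 2 eexists. Qed.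

Lemma ae_act g (P : torus -> Prop) : G g ->
  {ae mu, forall p, P p} -> {ae mu, forall p, P (act p g)}.
Proof.
move=> /G_rot[a [b ->]].
exact: (@ae_comp _ _ _ mu _ (measurable_act a b) (torus_measure_act a b)).
Qed.

Lemma ae_T' g f1 f2 : G g -> {ae mu, forall p, f1 p = f2 p} ->
  {ae mu, forall p, T' g f1 p = T' g f2 p}.
Proof.
move=> Gg /(ae_act Gg); apply: filterS => p f12.
by rewrite !T'E// f12.
Qed.

Lemma Lfun2_T' g f : G g -> f \in Lfun mu 2%:E -> T' g f \in Lfun mu 2%:E.
Proof.
move=> Gg; have [a [b gE]] := G_rot Gg.
move=> /(@Lfun2_comp _ _ _ mu _ (measurable_act a b) (torus_measure_act a b)) fL.
rewrite (_ : T' g f = fun p => sfac g.1 p.1 * sfac g.2 p.2 * f (act p g)); last first.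
  by apply/funext => p; rewrite T'E.
rewrite gE; apply: (@Lfun2_le _ _ _ _ _ _ _ _ fL).
  apply: measurable_funM; last exact: measurable_Lfun2 fL.
  apply: measurable_funM.
    exact: measurableT_comp (measurable_sfac_rot a) measurable_fst.
  exact: measurableT_comp (measurable_sfac_rot b) measurable_snd.
move=> p /=; rewrite normrM; apply: ler_piMl => //; rewrite (normrM (sfac _ _)).
by apply: mulr_ile1 => //; exact: sfac_le1.
Qed.

Lemma measurable_generic1 k : measurable (generic1 k : set (P1 R)).
Proof.
apply: bigcupT_measurable => i; apply: measurable_angle_image.
exact: interval_open.
Qed.

(** In the window [[0, 2 pi[] only multiples of [4 pi / k] are missed, and these
    are countably many. *)
Lemma P1_measure_generic1 k : (0 < k)%N -> P1_measure R (~` generic1 k) = 0%E.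
Proof.
move=> k0; rewrite /P1_measure /pushforward /mrestr.
have k0R : 0 < k%:R :> R by rewrite ltr0n.
have pi0 := pi_gt0 R.
pose grid := range (fun i : nat => 4 * pi * i%:R / k%:R).
have grid0 : lam grid = 0%E by apply: countable_lebesgue_measure0; exact: card_image_le.
have mgrid : measurable grid.
  rewrite /grid -bigcup_imset1; apply: bigcupT_measurable => i.
  exact: measurable_set1.
apply/eqP; rewrite -measure_le0 -grid0; apply/le_measure; rewrite ?inE//.
- by apply: measurableI => //; apply: measurableC; exact: measurable_generic1.
- move=> r [/= nr]; rewrite in_itv/= => /andP[r0 _].
  pose y := r * k%:R / (4 * pi); pose i := Num.truncn y.
  have y0 : 0 <= y by rewrite /y divr_ge0// ?mulr_ge0// ?ltW// mulr_gt0.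
  have rE : r = 4 * pi * y / k%:R.
    have fE (a b c : R) : b != 0 -> c != 0 -> a = 4 * c * (a * b / (4 * c)) / b.
      by move=> b0 c0; field; exact/andP.
    by apply: fE; exact: lt0r_neq0.
  have /andP[yi1 yi2] := truncn_itv y0.
  exists i => //; rewrite rE; apply/eqP; rewrite eq_le; apply/andP; split.
    by rewrite ler_pM2r ?invr_gt0// ler_pM2l ?mulr_gt0.
  rewrite leNgt; apply/negP => lt; apply: nr; exists i => //; exists r => //.
  rewrite /cell /= in_itv/= [X in _ < X < _]rE lt/=.
  by rewrite ltr_pM2r ?invr_gt0// ltr_pM2l ?mulr_gt0.
Qed.

Lemma ae_generic : {ae mu, forall p, generic p}.
Proof.
have mg k : measurable (generic1 k : set (P1 R)) by exact: measurable_generic1.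
have mC k : measurable (~` generic1 k : set (P1 R)) by exact: measurableC.
have null1 : mu (~` generic1 n `*` setT) = 0%E.
  apply: eq_trans (product_measure1E (P1_measure R) (P1_measure R) (mC n) measurableT) _.
  by apply: eq_trans (mul0e _); congr (_ * _)%E; exact: P1_measure_generic1.
have null2 : mu (setT `*` ~` generic1 m) = 0%E.
  apply: eq_trans (product_measure1E (P1_measure R) (P1_measure R) measurableT (mC m)) _.
  by apply: eq_trans (mule0 _); congr (_ * _)%E; exact: P1_measure_generic1.
exists ((~` generic1 n `*` setT) `|` (setT `*` ~` generic1 m)); split.
- by apply: measurableU; exact: measurableX.
- by rewrite measureU0//; exact: measurableX.
- move=> [x y] /= /not_andP[?|?]; by [left|right].
Qed.

End torus.

(** * Counting cosets *)

Section group.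
Context {R : realType}.
Local Notation M2 := 'M[R]_2.
Implicit Types (g h k : M2 * M2).

Variables (n m : nat).
Hypotheses (n_gt0 : (0 < n)%N) (m_gt0 : (0 < m)%N).
Hypotheses (n_even : ~~ odd n) (m_even : ~~ odd m).
Local Notation G := (Cn n `*` Cn m : set (M2 * M2)).
Local Notation K := (@Kgrp R).

Lemma mulG g h : G g -> G h -> G (g * h).
Proof. by move=> [g1 g2] [h1 h2]; split; exact: CnM. Qed.

Lemma mulGC g h : G g -> G h -> g * h = h * g.
Proof.
case: g h => [g1 g2] [h1 h2] [/= ? ?] [/= ? ?].
by congr pair; exact: (@mulrC_Cn R n) || exact: (@mulrC_Cn R m).
Qed.

Lemma G_rinv g : G g -> exists2 h, G h & g * h = 1.
Proof.
case: g => [g1 g2] [/= /(Cn_inv n_gt0)[h1 ? e1] /(Cn_inv m_gt0)[h2 ? e2]].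
by exists (h1, h2) => //; congr pair.
Qed.

Lemma G_unitr g : G g -> g \is a GRing.unit.
Proof.
move=> Gg; have [h Gh gh] := G_rinv Gg; apply/unitrP; exists h.
by rewrite mulGC.
Qed.

Lemma finite_G : finite_set G.
Proof. by apply: finite_setX; exact: finite_image. Qed.

Lemma Kgrp_sub k : K k -> G k.
Proof.
have N1n := @CnN1 R n n_gt0 n_even; have N1m := @CnN1 R m m_gt0 m_even.
have P1n := @Cn1 R n n_gt0; have P1m := @Cn1 R m m_gt0.
by case=> [[[]|]|] ->; split.
Qed.

Lemma Kgrp_sqr k : K k -> k * k = 1.
Proof.
by case=> [[[]|]|] ->; congr pair; rewrite /= ?mulrNN ?mulr1.
Qed.

Lemma mulKgrp k l : K k -> K l -> K (k * l).
Proof.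
have pairM (a b c d : M2) : (a, b) * (c, d) = (a * c, b * d) by [].
move=> [[[]|]|] -> [[[]|]|] ->; rewrite ?mulr1 ?mul1r ?pairM ?mulrNN ?mulr1 ?mul1r;
  by [left; left; left|left; left; right|left; right|right].
Qed.

Lemma Kgrp1 : K 1.
Proof. by left; left; left. Qed.

Lemma finite_Kgrp : finite_set K.
Proof. by apply: sub_finite_set finite_G => k; exact: Kgrp_sub. Qed.

Variables (F : set (M2 * M2)) (subgroup_F : is_subgroup F n m).

Lemma subgroup_sub f : F f -> G f. Proof. by case: subgroup_F => + _ _ _; apply. Qed.
Lemma subgroup1 : F 1. Proof. by case: subgroup_F. Qed.
Lemma subgroupM f g : F f -> F g -> F (f * g).
Proof. by case: subgroup_F => _ _ + _; apply. Qed.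
Lemma subgroupV f : F f -> F f^-1.
Proof. by case: subgroup_F => _ _ _; apply. Qed.
Lemma finite_subgroup : finite_set F.
Proof. by apply: sub_finite_set finite_G => k; exact: subgroup_sub. Qed.
Lemma finite_K_of : finite_set (K_of F).
Proof. by apply: sub_finite_set finite_subgroup => k []. Qed.

Lemma set_order_gt0 (A : set (M2 * M2)) a : finite_set A -> A a -> (0 < set_order A)%N.
Proof.
move=> fA Aa; rewrite /set_order cardfs_gt0; apply/fset0Pn; exists a.
by rewrite in_fset_set// inE.
Qed.

Section cover.
Variable g : 'I_(theta n m F) -> M2 * M2.
Hypothesis Gg : forall nu, G (g nu).
Hypothesis sep : forall (la nu : 'I_(theta n m F)) k f, (la < nu)%N -> K k -> F f ->
  g nu <> g la * k * f.

Lemma coset_sym h l k f : K k -> F f -> h = l * k * f -> l = h * k * f^-1.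
Proof.
move=> Kk Ff ->; have kf : f * k = k * f.
  by apply: mulGC; [exact: subgroup_sub|exact: Kgrp_sub].
rewrite -(mulrA _ f k) kf !mulrA mulrK; last by apply: G_unitr; exact: subgroup_sub.
by rewrite -mulrA Kgrp_sqr// mulr1.
Qed.

(** If [h] were missed, then [h] and the [g nu] would be theta + 1 inequivalent
    elements modulo K F.  Choose for each [z] in K F a factor [r z] in K with
    [z] in [r z] F.  Then (nu, k, f) |-> (g nu k f, r (k f) k) is an injection
    whose second component lies in K_F, since [r (k f) k] is both in K and of the
    form f' f^-1.  This gives (theta + 1) |K| |F| <= |G| |K_F|, contrary to the
    definition of [theta] as a quotient. *)
Lemma coset_cover h : G h -> exists nu k f, [/\ K k, F f & h = g nu * k * f].
Proof.
move=> Gh; apply: contrapT => no.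
(* [None] indexes the element [h] that is supposed to be missed. *)
pose g' (o : option 'I_(theta n m F)) := if o is Some nu then g nu else h.
have Gg' o : G (g' o) by case: o.
have sep' a b k f : K k -> F f -> g' a = g' b * k * f -> a = b.
  move=> Kk Ff; case: a b => [a|] [b|] //= e.
  - have [ab|ba|/ord_inj -> //] := ltngtP a b.
      by case: (sep ab Kk (subgroupV Ff)); exact: coset_sym e.
    by case: (sep ba Kk Ff).
  - by case: no; exists a, k, f^-1; split => //; [exact: subgroupV|exact: coset_sym e].
  - by case: no; exists b, k, f.
pose kset z := [set k | K k /\ exists2 f, F f & z = k * f]; pose r z := get (kset z).
have rP k f : K k -> F f -> kset (k * f) (r (k * f)).
  by move=> Kk Ff; apply: getPex; exists k; split => //; exists f.
pose code (x : option 'I_(theta n m F) * ((M2 * M2) * (M2 * M2))) :=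
  (g' x.1 * x.2.1 * x.2.2, r (x.2.1 * x.2.2) * x.2.1).
pose KF : seq _ := [seq (k, f) | k <- fset_set K, f <- fset_set F].
pose dom : seq _ := [seq (o, y) | o <- enum {: option 'I_(theta n m F)}, y <- KF].
pose cod : seq _ := [seq (x, k) | x <- fset_set G, k <- fset_set (K_of F)].
have domP x : x \in dom -> K x.2.1 /\ F x.2.2.
  case/allpairsP => -[w y] /= [_ /allpairsP[[k f] /= []]].
  rewrite !in_fset_set ?inE; [|exact: finite_subgroup|exact: finite_Kgrp].
  by move=> Kk Ff -> ->.
have udom : uniq dom.
  apply: allpairs_uniq; [exact: enum_uniq| |by move=> [? ?] [? ?]].
  by apply: allpairs_uniq; [exact: fset_uniq|exact: fset_uniq|move=> [? ?] [? ?]].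
have ucode : uniq (map code dom).
  rewrite map_inj_in_uniq// => -[w [k f]] [w' [k' f']] /domP[/= Kk Ff] /domP[/= Kk' Ff'].
  move=> e.
  have e1 : g' w * k * f = g' w' * k' * f' := congr1 fst e.
  have e2 : r (k * f) * k = r (k' * f') * k' := congr1 snd e.
  have ww : w = w'.
    apply: (sep' w w' (k' * k) (f' * f^-1)); first exact: mulKgrp.
      by apply: subgroupM => //; exact: subgroupV.
    rewrite (coset_sym Kk Ff (esym e1)).
    rewrite -(mulrA _ f' k) (@mulGC f' k) ?mulrA//; [exact: subgroup_sub|exact: Kgrp_sub].
  subst w'.
  have kf : k * f = k' * f'.
    by apply: (mulrI (G_unitr (Gg' w))); rewrite !mulrA.
  have kk : k = k'.
    have [Kr _] := rP _ _ Kk Ff.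
    by apply: (mulrI (G_unitr (Kgrp_sub Kr))); rewrite e2 kf.
  by subst k'; have -> : f = f' by apply: (mulrI (G_unitr (Kgrp_sub Kk))).
have sub : {subset map code dom <= cod}.
  move=> _ /mapP[[w [k f]] /domP[/= Kk Ff] ->].
  have [Kr [f' Ff' e]] := rP _ _ Kk Ff.
  apply/allpairsP; exists (code (w, (k, f))) => /=; split => //.
    rewrite in_fset_set ?inE; last exact: finite_G.
    by apply: mulG; [apply: mulG => //; exact: Kgrp_sub|exact: subgroup_sub].
  rewrite in_fset_set ?inE; last exact: finite_K_of.
  split; first exact: mulKgrp.
  have rk : r (k * f) * k * f = f'.
    by rewrite -mulrA [X in _ * X]e mulrA Kgrp_sqr// mul1r.
  have -> : r (k * f) * k = f' * f^-1.
    by rewrite -rk mulrK// G_unitr//; exact: subgroup_sub.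
  by apply: subgroupM => //; exact: subgroupV.
have := uniq_leq_size ucode sub.
rewrite size_map !size_allpairs -cardE card_option card_ord.
rewrite -!/(set_order _) leqNgt => /negP; apply.
rewrite (mulnC (set_order K)); apply: ltn_ceil.
by rewrite muln_gt0 (set_order_gt0 finite_subgroup subgroup1)
  (set_order_gt0 finite_Kgrp Kgrp1).
Qed.
End cover.

End group.

(** * The elementary region as a fundamental domain *)

(** Remove [x] together with [phi x]. *)
Lemma even_card_involution (T : choiceType) (phi : T -> T) (A : {fset T}) :
  {in A, forall x, phi x \in A} -> {in A, forall x, phi (phi x) = x} ->
  {in A, forall x, phi x != x} -> ~~ odd #|` A|.
Proof.
have [N leN] := ubnP #|` A|; elim: N A leN => // N IH A.
rewrite ltnS => leN phiA phiK phiF.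
have [->|[x xA]] := fset_0Vmem A; first by rewrite cardfs0.
have cA : #|` A| = #|` (A `\ x `\ phi x)%fset|.+2.
  rewrite (cardfsD1 x) xA (cardfsD1 (phi x) (A `\ x)%fset).
  by rewrite in_fsetD1 phiF// phiA.
rewrite cA /= negbK; apply: IH => [|y|y|y]; first by rewrite cA in leN; lia.
- rewrite !in_fsetD1 => /and3P[y1 y2 yA]; rewrite phiA// andbT; apply/andP; split.
    by apply: contra_neq y2 => e; rewrite -(phiK y)// e phiK.
  by apply: contra_neq y1 => e; rewrite -e phiK.
- by rewrite !in_fsetD1 => /and3P[_ _]; exact: phiK.
- by rewrite !in_fsetD1 => /and3P[_ _]; exact: phiF.
Qed.

Section domain.
Context {R : realType}.
Local Notation M2 := 'M[R]_2.
Implicit Types (g h k : M2 * M2) (p q : P1 R * P1 R).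

Variables (n m : nat).
Hypotheses (n_gt0 : (0 < n)%N) (m_gt0 : (0 < m)%N).
Hypotheses (n_even : ~~ odd n) (m_even : ~~ odd m).
Local Notation G := (Cn n `*` Cn m : set (M2 * M2)).
Local Notation K := (@Kgrp R).

Lemma Fnm_generic q : Fnm n m q -> generic n m q.
Proof.
by move=> [r hr [s hs] <-]; split; exists 0%N => //=; [exists r|exists s];
  rewrite // cell0.
Qed.

Lemma to_Fnm p : generic n m p -> exists2 g, G g & Fnm n m (act p g).
Proof.
move=> [/= /(mobius_to_cell0 n_gt0)[a Ca [r + ra]]
  /(mobius_to_cell0 m_gt0)[b Cb [s + sb]]].
rewrite !cell0 => hr hs; exists (a, b) => //.
by exists r => //; exists s => //; rewrite /act ra sb.
Qed.

Lemma Fnm_stab q g : Fnm n m q -> G g -> Fnm n m (act q g) -> K g.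
Proof.
case: g => a b [r hr [s hs] <-] [/= Ca Cb] [r' hr' [s' hs'] [ra sb]].
have ha : a = 1 \/ a = -1.
  by apply: (cell0_rot n_gt0 n_even _ _ Ca (esym ra)); rewrite cell0.
have hb : b = 1 \/ b = -1.
  by apply: (cell0_rot m_gt0 m_even _ _ Cb (esym sb)); rewrite cell0.
case: ha hb => -> [] ->.
- by left; left; left.
- by right.
- by left; right.
- by left; left; right.
Qed.

Variables (F : set (M2 * M2)) (subgroup_F : is_subgroup F n m).
Let FG := subgroup_sub subgroup_F.

(** If [F] has odd order, an element of order 2 is impossible: multiplication by
    it would pair off the elements of [F].  In class E_1, (-1, -1) is in [F], and
    together with (-1, 1) or (1, -1) it would generate the whole of K. *)
Lemma K_of_diag : class_O F \/ class_E1 F -> forall k, K_of F k -> k = 1 \/ k = (-1, -1).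
Proof.
move=> cl k [Kk Fk]; have [FF1 FFM] : F 1 /\ forall f g, F f -> F g -> F (f * g).
  by case: subgroup_F.
case: cl => [oddF|[_ nD sA]].
  left; apply: contrapT => k1; move: oddF; apply/negP.
  apply: (@even_card_involution _ (fun f => f * k)) => f;
    rewrite in_fset_set ?inE; try exact: finite_subgroup subgroup_F.
  - move=> Ff; rewrite in_fset_set ?inE; first exact: FFM.
    exact: finite_subgroup subgroup_F.
  - by move=> _; rewrite -mulrA Kgrp_sqr// mulr1.
  - move=> Ff; apply/eqP => e; apply: k1.
    by apply: (mulrI (G_unitr n_gt0 m_gt0 (FG Ff))); rewrite e mulr1.
have FN : F (-1, -1) by apply: sA; right.
have pairM (a b c d : M2) : (a, b) * (c, d) = (a * c, b * d) by [].
case: Kk Fk => [[[->|->]|->]|->] Fk; [by left|by right| |]; exfalso; apply: nD.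
  have := FFM _ _ Fk FN; rewrite pairM mulrNN mulr1 mul1r => FN'.
  by move=> l [[[]|]|] ->.
have := FFM _ _ Fk FN; rewrite pairM mulrNN mulr1 mul1r => FN'.
by move=> l [[[]|]|] ->.
Qed.

Variables (S : set (M2 * M2)) (admissible_S : admissible n m F S).
Local Notation E := (region n m S).

(** The representatives of K / K_F in an admissible choice leave the region
    unchanged, because K fixes all points; in the separation condition they
    exhaust K, because K_F is absorbed by [F]. *)
Lemma region_transversal : exists g : 'I_(theta n m F) -> M2 * M2,
  [/\ forall nu, G (g nu),
      forall (la nu : 'I_(theta n m F)) k f, (la < nu)%N -> K k -> F f ->
        g nu <> g la * k * f
    & forall p, E p <-> exists nu, exists2 q, Fnm n m q & p = act q (g nu)].
Proof.
have [g [s [Gg sK sep ->]]] := admissible_S.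
have KS nu : exists mu, lcoset (s nu mu) (K_of F) 1.
  by have [mu [? _]] := (sK nu).2 1 Kgrp1; exists mu.
exists g; split => //.
  move=> la nu k f lanu Kk Ff e.
  have [mu [[kappa [_ Fkappa] kE] _]] := (sK la).2 k Kk.
  apply: (sep la nu mu lanu); exists (kappa * f).
    exact: (subgroupM subgroup_F Fkappa Ff).
  by rewrite e -kE !mulrA.
have actS q nu mu : Fnm n m q -> act q (g nu * s nu mu) = act q (g nu).
  move=> /Fnm_generic gq.
  have Ks := (sK nu).1 mu.
  rewrite -(@actM R n m)//; last exact: Kgrp_sub.
  by apply: (@act_Kgrp R n m) => //; exact: generic_act.
move=> p; split=> [[_ [nu [mu ->]] [q Fq <-]]|[nu [q Fq ->]]].
  by exists nu, q => //; rewrite actS.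
have [mu _] := KS nu; exists (g nu * s nu mu); first by exists nu, mu.
by exists q => //; rewrite actS.
Qed.

(** Bring [p] into the basic cell by some [w]; the inverse of [w] lies in some
    [g nu] K F, and its component in [F] is the one to undo. *)
Lemma region_meets_orbit p : generic n m p -> exists2 f, F f & E (act p f).
Proof.
have [g [Gg sep Ep]] := region_transversal.
move=> gp; have [w Gw Fw] := to_Fnm gp.
have [v Gv wv] := G_rinv n_gt0 m_gt0 Gw.
have [nu [k [f [Kk Ff vE]]]] :=
  coset_cover n_gt0 m_gt0 n_even m_even subgroup_F Gg sep Gv.
have GF := FG Ff.
have FfV : F f^-1 by case: subgroup_F => _ _ _; apply.
exists f^-1 => //; apply/Ep; exists nu, (act p w) => //.
have Gk := Kgrp_sub n_gt0 m_gt0 n_even m_even Kk.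
have Gfv := FG FfV.
rewrite -[RHS](@act_Kgrp R n m k) //; last first.
  by apply: generic_act => //; exact: generic_act.
have GG := @mulG R n m n_gt0 m_gt0.
rewrite !(@actM R n m) //; try (by apply: GG); try exact: generic_act.
congr act; rewrite -[LHS]mul1r -wv vE -!mulrA mulrV ?mulr1//.
exact: (G_unitr n_gt0 m_gt0 GF).
Qed.

(** If [p] comes from [g nu] and its image under [f] from [g nu'], then
    [g nu * f] and [g nu'] differ by an element of K, as only K maps the basic
    cell to itself.  Separation gives nu = nu', and then [f] is in K. *)
Lemma region_stab p f : F f -> E p -> E (act p f) -> K f.
Proof.
have [g [Gg sep Ep]] := region_transversal.
move=> Ff /Ep[nu [q Fq ->]] /Ep[nu' [q' Fq' e]].
have gq := Fnm_generic Fq; have gq' := Fnm_generic Fq'.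
have GG := @mulG R n m n_gt0 m_gt0.
have GF := FG Ff.
have [v Gv gv] := G_rinv n_gt0 m_gt0 (Gg nu').
have e' : act q (g nu * f * v) = q'.
  rewrite -!(@actM R n m)//; try (by apply: GG); try (by apply: generic_act).
  rewrite e (@actM R n m)// gv; exact: act1 gq'.
have Kk : K (g nu * f * v).
  apply: (@Fnm_stab q) => //; first by apply: (mulG n_gt0 m_gt0) => //; apply: GG.
  by rewrite e'.
set k := g nu * f * v in Kk.
have gk : g nu * f = k * g nu'.
  by rewrite /k -mulrA -(@mulGC R n m _ v) // gv mulr1.
have Gk := Kgrp_sub n_gt0 m_gt0 n_even m_even Kk.
have ge : g nu' = g nu * k * f.
  rewrite -mulrA (@mulGC R n m k f)// mulrA gk -mulrA (@mulGC R n m (g nu') k)// mulrA.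
  by rewrite Kgrp_sqr// mul1r.
have [lt|lt|/ord_inj nn] := ltngtP nu nu'.
- by case: (sep _ _ _ _ lt Kk Ff).
- have FfV : F f^-1 by case: subgroup_F => _ _ _; apply.
  case: (sep _ _ _ _ lt Kk FfV).
  exact: (coset_sym n_gt0 m_gt0 n_even m_even subgroup_F Kk Ff ge).
subst nu'.
have -> : f = k; last by [].
apply: (mulrI (G_unitr n_gt0 m_gt0 (Gg nu))).
by rewrite gk (@mulGC R n m).
Qed.

End domain.

(** * Spaces of fixed functions *)

Lemma ae_finite_forall d (T : measurableType d) (R : realType)
    (mu : {measure set T -> \bar R}) (I : choiceType) (A : set I) (P : I -> T -> Prop) :
  finite_set A -> (forall i, A i -> {ae mu, forall x, P i x}) ->
  {ae mu, forall x, forall i, A i -> P i x}.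
Proof.
move=> fA AP.
have : {ae mu, forall x, forall i, i \in (fset_set A : seq I) -> P i x}.
  have : forall i, i \in (fset_set A : seq I) -> {ae mu, forall x, P i x}.
    by move=> i; rewrite in_fset_set// inE; exact: AP.
  elim: (fset_set A : seq I) => [_|i s IH sP]; first exact: aeW.
  have := sP i (mem_head i s).
  have : {ae mu, forall x, forall i, i \in s -> P i x}.
    by apply: IH => j js; apply: sP; rewrite inE js orbT.
  by apply: filterS2 => x Ps Pi j; rewrite inE => /orP[/eqP ->|/Ps].
by apply: filterS => x Ps i Ai; apply: Ps; rewrite in_fset_set// inE.
Qed.

Section spaces.
Context {R : realType}.
Local Notation M2 := 'M[R]_2.
Local Notation mu := (torus_measure R).
Local Notation fn u := (u : P1 R * P1 R -> R).
Implicit Types (g h k : M2 * M2) (p q : P1 R * P1 R) (u v w : H_torus R).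
Implicit Types f : P1 R * P1 R -> R.

Variables (n m : nat).
Hypotheses (n_gt0 : (0 < n)%N) (m_gt0 : (0 < m)%N).
Hypotheses (n_even : ~~ odd n) (m_even : ~~ odd m).
Local Notation G := (Cn n `*` Cn m : set (M2 * M2)).
Let ae_gen := ae_generic n_gt0 m_gt0 : {ae mu, forall p, generic n m p}.

Variables (F : set (M2 * M2)) (subgroup_F : is_subgroup F n m).
Let FG : forall g, F g -> G g := subgroup_sub subgroup_F.
Let finF : finite_set F := finite_subgroup subgroup_F.
Let L0 : (cst 0 : P1 R * P1 R -> R) \in Lfun mu 2%:E :=
  LfunP (cst 0 : LfunType mu (@lee1n R 2)).

(** The finitely many equations may be imposed at the same points. *)
Lemma fixed_spaceP u : fixed_space F u <->
  {ae mu, forall p, forall h, F h -> T' h u p = fn u p}.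
Proof.
split=> [Fu|Fu h Fh].
  apply: ae_finite_forall => // h Fh.
  have := ae_toL2 (Lfun2_T' (FG Fh) (Lspace_Lfun2 u)).
  by rewrite -/(T'_L2 h u) Fu//; apply: filterS => p ->.
rewrite -[RHS]toL2K; apply: toL2_eq.
- by apply: Lfun2_T' (FG Fh) _; exact: Lspace_Lfun2.
- exact: Lspace_Lfun2.
- by apply: filterS Fu => p; exact.
Qed.

Lemma fixed_space_toL2 f : f \in Lfun mu 2%:E ->
  {ae mu, forall p, forall h, F h -> T' h f p = f p} ->
  fixed_space F (toL2 mu f).
Proof.
move=> fL fF; apply/fixed_spaceP.
have e := ae_toL2 fL.
have eF : {ae mu, forall p, forall h, F h -> T' h (toL2 mu f) p = T' h f p}.
  by apply: ae_finite_forall => // h Fh; exact: ae_T' (FG Fh) e.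
near=> p => h Fh.
have -> : T' h (toL2 mu f) p = T' h f p by move: h Fh; near: p.
have -> : T' h f p = f p by move: h Fh; near: p.
by apply/esym; near: p.
Unshelve. all: by end_near. Qed.

(** Both elements act as - id on functions. *)
Lemma fixed_space_trivial : F (-1, 1) \/ F (1, -1) ->
  fixed_space F = [set toL2 mu (cst 0)].
Proof.
move=> FN; apply/seteqP; split => [u /fixed_spaceP uF|_ ->]; last first.
  apply: fixed_space_toL2 => //; apply: aeW => p h _.
  by rewrite /T' /= mulr0.
rewrite /= -(toL2K u); apply: toL2_eq => //; first exact: Lspace_Lfun2.
have neg (x : R) : - x = x -> x = 0 by move=> ?; lra.
by case: FN => FN; apply: filterS2 ae_gen uF => p gp /(_ _ FN);
  rewrite ?(T'N11 n_gt0 m_gt0 n_even m_even)// ?(T'1N1 n_gt0 m_gt0 n_even m_even)//;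
  exact: neg.
Qed.

(** When [f] is supported in [E], only |K_F| terms can be nonzero at a point of
    [E]: hence the normalization by |K_F| and not by |F|. *)
Definition average f p : R :=
  (set_order (K_of F))%:R^-1 * \sum_(g \in F) T' g f p.

Lemma Lfun2_average f : f \in Lfun mu 2%:E -> average f \in Lfun mu 2%:E.
Proof.
move=> fL.
have sL : (fun p => \sum_(g <- fset_set F) T' g f p) \in Lfun mu 2%:E.
  apply: Lfun2_sum => g; rewrite in_fset_set// inE => Fg.
  exact: Lfun2_T' (FG Fg) fL.
rewrite (_ : average f = (set_order (K_of F))%:R^-1 \o*
    (fun p => \sum_(g <- fset_set F) T' g f p)).
  by apply: Lfun_scale sL; rewrite ler1n.
by apply/funext => p; rewrite /= mulrC /average fsbig_finite.
Qed.

(** Translation by [h] permutes [F]. *)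
Lemma T'_average f h p : F h -> generic n m p -> T' h (average f) p = average f p.
Proof.
move=> Fh gp; rewrite (T'E _ _ (FG Fh)) /average mulrCA; congr (_ * _).
rewrite mulr_fsumr.
transitivity (\sum_(g \in F) T' (h * g) f p).
  apply: eq_fsbigr => g; rewrite inE => Fg.
  rewrite -(T'M n_gt0 m_gt0 n_even m_even _ (FG Fh) (FG Fg))//.
  by rewrite [RHS](T'E _ _ (FG Fh)).
rewrite [RHS](reindex_fsbig ( *%R h) F F)//.
have uh := G_unitr n_gt0 m_gt0 (FG Fh).
split=> [g Fg|g g' _ _|g Fg] /=.
- exact: (subgroupM subgroup_F).
- exact: mulrI.
- exists (h^-1 * g); last by rewrite mulVKr.
  by apply: (subgroupM subgroup_F) => //; exact: (subgroupV subgroup_F).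
Qed.

Lemma fixed_space_average f : f \in Lfun mu 2%:E ->
  fixed_space F (toL2 mu (average f)).
Proof.
move=> fL; apply: fixed_space_toL2; first exact: Lfun2_average.
by apply: filterS ae_gen => p gp h Fh; exact: T'_average.
Qed.

Hypothesis cl : class_O F \/ class_E1 F.

Lemma T'_K_of k f p : K_of F k -> generic n m p -> T' k f p = f p.
Proof.
move=> /(K_of_diag n_gt0 m_gt0 subgroup_F cl)[] -> gp.
  exact: T'1 gp.
exact: T'N1N1 gp.
Qed.

Variables (S : set (M2 * M2)) (adm : admissible n m F S).
Local Notation E := (region n m S).

(** Almost every point can be moved into the region by an element of [F], and
    the value of a fixed function changes by a sign that depends only on the
    point and on that element. *)
Lemma fixed_space_eq u v : fixed_space F u -> fixed_space F v ->
  {ae mu, forall p, E p -> fn u p = fn v p} -> u = v.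
Proof.
move=> /fixed_spaceP Fu /fixed_spaceP Fv uv.
rewrite -(toL2K u) -(toL2K v).
apply: toL2_eq; [exact: Lspace_Lfun2|exact: Lspace_Lfun2|].
have uvF : {ae mu, forall p, forall h, F h -> E (act p h) ->
    fn u (act p h) = fn v (act p h)}.
  by apply: ae_finite_forall => // h Fh; exact: ae_act (FG Fh) uv.
near=> p.
have gp : generic n m p by near: p; exact: ae_gen.
have [h Fh Eph] := region_meets_orbit n_gt0 m_gt0 n_even m_even subgroup_F adm gp.
have <- : T' h u p = fn u p by move: h Fh {Eph}; near: p.
have <- : T' h v p = fn v p by move: h Fh {Eph}; near: p.
rewrite !(T'E _ _ (FG Fh)); congr (_ * _).
by move: h Fh Eph; near: p.
Unshelve. all: by end_near. Qed.

(** At a point of [E], the terms with [g] outside K vanish since they evaluate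
    [f] outside [E], and the others are all equal to the value of [f]. *)
Lemma average_region f : {ae mu, forall p, ~ E p -> f p = 0} ->
  {ae mu, forall p, E p -> average f p = f p}.
Proof.
move=> f0.
have f0F : {ae mu, forall p, forall h, F h -> ~ E (act p h) -> f (act p h) = 0}.
  by apply: ae_finite_forall => // h Fh; exact: ae_act (FG Fh) f0.
apply: filterS2 ae_gen f0F => p gp fp Ep.
rewrite /average -(@fsbig_widen _ _ _ _ (K_of F)); last 2 first.
- by move=> k [].
- move=> h [Fh nK] /=; rewrite (T'E _ _ (FG Fh)) fp ?mulr0// => Eh.
  apply: nK; split => //.
  exact: (region_stab n_gt0 m_gt0 n_even m_even subgroup_F adm Fh Ep Eh).
transitivity ((set_order (K_of F))%:R^-1 * \sum_(k \in K_of F) f p).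
  by congr (_ * _); apply: eq_fsbigr => k; rewrite inE => Kk; exact: T'_K_of.
have finK := finite_K_of subgroup_F.
rewrite fsbig_finite// big_const_seq count_predT iter_addr_0.
rewrite -[f p *+ _]mulr_natl mulrA mulVf ?mul1r//.
rewrite pnatr_eq0 -lt0n; apply: (set_order_gt0 finK (a := 1)).
by split; [exact: Kgrp1|case: subgroup_F].
Qed.

Let mE : measurable E := measurable_region adm.
Local Notation muE := (mrestr mu mE).

Lemma restrict_toP u (v : H_on mE) :
  restrict_to mE u = v <-> {ae mu, forall p, E p -> fn u p = fn v p}.
Proof.
have uL : fn u \in Lfun muE 2%:E by apply: Lfun2_restrict; exact: Lspace_Lfun2.
have e := ae_toL2 uL.
split=> [<-|uv]; first by apply/(ae_mrestr _ mE); apply: filterS e => p ->.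
rewrite -[RHS](toL2K v); apply: toL2_eq => //; first exact: Lspace_Lfun2.
exact/ae_mrestr.
Qed.

Lemma ae_extend0 (v : H_on mE) :
  {ae mu, forall p, fn (extend0 v) p = if p \in E then fn v p else 0}.
Proof.
apply: ae_toL2.
rewrite (_ : (fun p => _) = fn v \* \1_E).
  exact/Lfun2_extend/Lspace_Lfun2.
by apply/funext => p /=; rewrite indicE; case: ifP; rewrite ?mulr1 ?mulr0.
Qed.

Lemma ae_rho_map u :
  {ae mu, forall p, fn (rho_map E u) p = if p \in E then fn u p else 0}.
Proof.
have uL : \1_E \* fn u \in Lfun mu 2%:E.
  apply: (Lfun2_le _ _ (Lspace_Lfun2 u)).
    apply: measurable_funM; first exact: measurable_indic.
    exact: (measurable_Lfun2 (Lspace_Lfun2 u)).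
  by move=> p /=; rewrite indicE; case: (p \in E); rewrite ?mul1r// mul0r normr0.
apply: filterS (ae_toL2 uL) => p -> /=; rewrite indicE.
by case: ifP; rewrite ?mul1r ?mul0r.
Qed.

Lemma ae_sigma_map u : {ae mu, forall p, fn (sigma_map F u) p = average u p}.
Proof. by apply: ae_toL2; apply: Lfun2_average; exact: Lspace_Lfun2. Qed.

Lemma fixed_sigma_map u : fixed_space F (sigma_map F u).
Proof. by apply: fixed_space_average; exact: Lspace_Lfun2. Qed.

Lemma sigma_map_region u : supported_in E u ->
  {ae mu, forall p, E p -> fn (sigma_map F u) p = fn u p}.
Proof.
move=> /average_region; apply: filterS2 (ae_sigma_map u) => p -> up; exact: up.
Qed.

Lemma supported_extend0 (v : H_on mE) : supported_in E (extend0 v).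
Proof. by apply: filterS (ae_extend0 v) => p -> Ep; rewrite memNset. Qed.

Lemma supported_rho_map u : supported_in E (rho_map E u).
Proof. by apply: filterS (ae_rho_map u) => p -> Ep; rewrite memNset. Qed.

Lemma supported_eq u v : supported_in E u -> supported_in E v ->
  {ae mu, forall p, E p -> fn u p = fn v p} -> u = v.
Proof.
move=> u0 v0 uv; rewrite -(toL2K u) -(toL2K v).
apply: toL2_eq; [exact: Lspace_Lfun2|exact: Lspace_Lfun2|].
near=> p; have [Ep|Ep] := pselect (E p); first by move: Ep; near: p.
have -> : fn u p = 0 by move: Ep; near: p.
by apply/esym; move: Ep; near: p.
Unshelve. all: by end_near. Qed.

Lemma extend0_region (v : H_on mE) :
  {ae mu, forall p, E p -> fn (extend0 v) p = fn v p}.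
Proof. by apply: filterS (ae_extend0 v) => p -> Ep; rewrite mem_set. Qed.

Lemma rho_map_region u : {ae mu, forall p, E p -> fn (rho_map E u) p = fn u p}.
Proof. by apply: filterS (ae_rho_map u) => p -> Ep; rewrite mem_set. Qed.

Lemma extend0_restrict_to_bij : inverse_bijections [set: H_on mE] (supported_in E)
  (extend0 (mE := mE)) (restrict_to mE).
Proof.
split=> [v _|//|v _|u u0].
- exact: supported_extend0.
- by apply/restrict_toP; exact: extend0_region.
- apply: supported_eq => //; first exact: supported_extend0.
  have := (restrict_toP u (restrict_to mE u)).1 erefl.
  by apply: filterS2 (extend0_region (restrict_to mE u)) => p e1 e2 Ep; rewrite e1// e2.
Qed.

Lemma sigma_rho_bij : inverse_bijections (supported_in E) (fixed_space F)
  (sigma_map F) (rho_map E).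
Proof.
split=> [u _|u _|u u0|v Fv].
- exact: fixed_sigma_map.
- exact: supported_rho_map.
- apply: supported_eq => //; first exact: supported_rho_map.
  apply: filterS2 (rho_map_region (sigma_map F u)) (sigma_map_region u0).
  by move=> p e1 e2 Ep; rewrite e1// e2.
- apply: fixed_space_eq => //; first exact: fixed_sigma_map.
  apply: filterS2 (rho_map_region v) (sigma_map_region (@supported_rho_map v)).
  by move=> p e1 e2 Ep; rewrite e2// e1.
Qed.

Lemma fixed_space_restrict_to (u : H_on mE) :
  exists! v : H_torus R, fixed_space F v /\ restrict_to mE v = u.
Proof.
exists (sigma_map F (extend0 u)); split.
  split; first exact: fixed_sigma_map.
  apply/restrict_toP.
  apply: filterS2 (extend0_region u) (sigma_map_region (@supported_extend0 u)).
  by move=> p e1 e2 Ep; rewrite e2// e1.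
move=> v [Fv /restrict_toP vu]; apply: fixed_space_eq => //; first exact: fixed_sigma_map.
apply: filterS3 vu (extend0_region u) (sigma_map_region (@supported_extend0 u)).
by move=> p e1 e2 e3 Ep; rewrite e3// e2// e1.
Qed.

End spaces.

Theorem theorem3 (R : realType) (n m : nat)
    (n_gt0 : (0 < n)%N) (m_gt0 : (0 < m)%N)
    (n_even : ~~ odd n) (m_even : ~~ odd m)
    (F : set ('M[R]_2 * 'M[R]_2)) (subgroup_F : is_subgroup F n m) :
  ((class_E2 F \/ class_E3 F \/ class_E4 F) ->
     fixed_space F = [set toL2 (torus_measure R) (cst 0)])
  /\
  ((class_O F \/ class_E1 F) ->
     forall (S : set ('M[R]_2 * 'M[R]_2)) (admissible_S : admissible n m F S),
     let E := region n m S in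
     let mE : measurable E := measurable_region admissible_S in
     [/\ forall u : H_on mE,
           exists! v : H_torus R, fixed_space F v /\ restrict_to mE v = u,
         inverse_bijections [set: H_on mE] (supported_in E)
           (extend0 (mE := mE)) (restrict_to mE)
       & inverse_bijections (supported_in E) (fixed_space F)
           (sigma_map F) (rho_map E)]).
Proof.
split=> [cl|cl S adm E mE].
  apply: (fixed_space_trivial n_gt0 m_gt0 n_even m_even subgroup_F).
  case: cl => [[_ _ BF]|[[_ _ CF]|[_ DF]]].
  - by left; apply: BF; right.
  - by right; apply: CF; right.
  - by left; apply: DF; left; right.
split.
- exact: fixed_space_restrict_to.
- exact: extend0_restrict_to_bij.
- exact: sigma_rho_bij.
Qed.
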